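(* For each integer $d\ge 2$ let $\lambda=\lambda(d)>0$, and suppose that $$\liminf_{d\to\infty}\frac{\lambda\kappa_d}{d}>2 .$$ Suppose moreover that the limit $x:=\lim_{d\to\infty}\frac1d\log(\lambda\kappa_d)$ exists in $[0,\infty]$. Let $h^{(d)}_\lambda:=h^{(d)}_\lambda(u)$ denote the support function of the Poisson polytope $K^d_\lambda$ in a direction $u\in\mathbb S^{d-1}$ (its law does not depend on $u$). Then the following holds in probability as $d\to\infty$: (a) if $x=0$, then $h^{(d)}_\lambda\sim\sqrt{\frac2d\log(\lambda\kappa_d)}$, i.e. the ratio of the two sides tends to $1$ in probability; (b) if $x\in(0,\infty)$, then $h^{(d)}_\lambda\to\sqrt{1-e^{-2x}}$; (c) if $x=\infty$, then $1-h^{(d)}_\lambda\sim\frac12(\lambda\kappa_d)^{-\frac{2}{d+1}}$, i.e. the ratio of the two sides tends to $1$ in probability.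
   Context: $\mathbb B^d$ is the closed Euclidean unit ball of $\mathbb R^d$, $\mathbb S^{d-1}$ the unit sphere, and $\kappa_d=\pi^{d/2}/\Gamma(1+\frac d2)$ is the volume of $\mathbb B^d$. For each $d\ge2$, $\mathcal P^d_\lambda$ is a homogeneous Poisson point process on $\mathbb R^d$ with intensity $\lambda=\lambda(d)>0$ (all defined on a common probability space), and $K^d_\lambda$ is the convex hull of $\mathcal P^d_\lambda\cap\mathbb B^d$. The support function of $K^d_\lambda$ is $h^{(d)}_\lambda(u):=\sup\{\langle u,x\rangle:x\in K^d_\lambda\}$ for $u\in\mathbb S^{d-1}$, with value $-\infty$ if $K^d_\lambda$ is empty. *)

(* Defs.v *)
From HB Require Import structures.
From mathcomp Require Import all_boot all_order all_algebra.
From mathcomp Require Import all_classical all_reals all_analysis.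
From mathcomp Require Import measurable_realfun.

Set Implicit Arguments.
Unset Strict Implicit.
Unset Printing Implicit Defensive.

Import Order.TTheory GRing.Theory Num.Theory.
Import numFieldNormedType.Exports.

Local Open Scope classical_set_scope.
Local Open Scope ring_scope.

(* R^d is 'rV[R]_d.  Its library norm `|x| is the max norm, hence the Euclidean
   dot product and norm below.  It gets the sigma-algebra generated by the
   coordinates, i.e. the Borel one, as the library does for d.-tuple R. *)
Section measurable_row.
Context {R : realType} (d : nat).

Definition row_coord (i : 'I_d) (x : 'rV[R]_d) : R := x 0 i.

Let row_set0 : g_sigma_preimage row_coord set0.
Proof. exact: sigma_algebra0. Qed.

Let row_setC A : g_sigma_preimage row_coord A -> g_sigma_preimage row_coord (~` A).
Proof. exact: sigma_algebraC. Qed.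

Let row_bigcup (F : (set 'rV[R]_d)^nat) :
  (forall i, g_sigma_preimage row_coord (F i)) ->
  g_sigma_preimage row_coord (\bigcup_i (F i)).
Proof. exact: sigma_algebra_bigcup. Qed.

HB.instance Definition _ := @isMeasurable.Build default_measure_display
  'rV[R]_d (g_sigma_preimage row_coord) row_set0 row_setC row_bigcup.

End measurable_row.

Lemma measurable_row_coord {R : realType} d (i : 'I_d) :
  measurable_fun [set: 'rV[R]_d] (row_coord i).
Proof.
move=> _ Y mY; rewrite setTI; apply: sub_sigma_algebra => /=.
rewrite -bigcup_seq/=; exists i => /=; first by rewrite mem_index_enum.
by exists Y => //; rewrite setTI.
Qed.

Lemma measurable_fun_rowP {R : realType} dp (T : measurableType dp) d
    (f : T -> 'rV[R]_d) :
  (forall i, measurable_fun [set: T] (row_coord i \o f)) -> measurable_fun [set: T] f.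
Proof.
move=> mf; apply: (@measurability _ _ _ _ _ _
  (\big[setU/set0]_(i < d) preimage_set_system setT (row_coord i) measurable)) => //.
move=> _ [B + <-].
rewrite -bigcup_seq => -[i /= _ [C mC <-]].
rewrite !setTI -comp_preimage.
by rewrite -[X in measurable X]setTI; apply: (mf i).
Qed.

Lemma measurable_row_cons {R : realType} d :
  measurable_fun setT (fun p : R * 'rV[R]_d =>
     row_mx p.1%:M p.2 : 'rV[R]_d.+1).
Proof.
apply: measurable_fun_rowP => i.
case: (@splitP 1 d i) => j ij.
  rewrite (_ : _ \o _ = fst) // funeqE => -[x y] /=; rewrite /row_coord.
  have -> : i = lshift d j by exact: val_inj.
  apply: etrans; first exact: row_mxEl.
  by rewrite (ord1 j) mxE mulr1n.
rewrite (_ : _ \o _ = @row_coord R d j \o snd).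
  exact: (measurableT_comp (measurable_row_coord j)).
rewrite funeqE => -[x y] /=; rewrite /row_coord.
have -> : i = rshift 1 j by exact: val_inj.
exact: row_mxEr.
Qed.

(* d-dimensional Lebesgue measure: the d-fold product of the Lebesgue measure on
   R, one coordinate split off at a time; see lebesgue_rV_box. *)
Fixpoint lebesgue_rV {R : realType} {d : nat} : set 'rV[R]_d -> \bar R :=
  match d with
  | 0 => \d_(0 : 'rV[R]_0)
  | d'.+1 => pushforward (@lebesgue_measure R \x @lebesgue_rV R d')%E
               (fun p => row_mx p.1%:M p.2 : 'rV[R]_d'.+1)
  end.

Section lebesgue_rV_measure.
Context {R : realType}.

Let cons_row d (p : (R * 'rV[R]_d)%type) : 'rV[R]_d.+1 :=
  row_mx p.1%:M p.2.

Let cons_row0 d p : @cons_row d p 0 0 = p.1.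
Proof.
rewrite /cons_row; have -> : 0 = lshift d 0 :> 'I_(1 + d) by exact: val_inj.
by apply: etrans; [exact: row_mxEl|rewrite mxE mulr1n].
Qed.

Let cons_rowS d p (i : 'I_d) : @cons_row d p 0 (lift 0 i) = p.2 0 i.
Proof.
rewrite /cons_row.
have -> : lift 0 i = rshift 1 i :> 'I_(1 + d) by exact: val_inj.
exact: row_mxEr.
Qed.

Let pushforward_cons_sigma_finite d
    (m : {sigma_finite_measure set 'rV[R]_d -> \bar R}) :
  sigma_finite setT (pushforward (@lebesgue_measure R \x m)%E (@cons_row d)).
Proof.
pose uncons (x : 'rV[R]_d.+1) : R * 'rV[R]_d :=
  (x 0 0, \row_i x 0 (lift 0 i)).
have consK : cancel (@cons_row d) uncons.
  move=> [x y]; rewrite /uncons cons_row0 /=; congr pair.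
  by apply/rowP => i; rewrite mxE cons_rowS.
have muncons : measurable_fun setT uncons.
  apply/measurable_fun_pairP; split.
    exact: (measurable_row_coord 0).
  apply: measurable_fun_rowP => i.
  rewrite (_ : _ \o _ = row_coord (lift 0 i)).
    exact: measurable_row_coord.
  by apply/funext => x; rewrite /row_coord /= mxE.
have /sigma_finiteP[F [TF ndF Foo]] := sigma_finiteT (@lebesgue_measure R).
have /sigma_finiteP[G [TG ndG Goo]] := sigma_finiteT m.
exists (fun n => uncons @^-1` (F n `*` G n)).
  rewrite -preimage_bigcup [X in _ @^-1` X](_ : _ = setT) ?preimage_setT//.
  apply/seteqP; split=> // -[x y] _.
  have [n _ Fx] : (\bigcup_i F i) x by rewrite -TF.
  have [k _ Gy] : (\bigcup_i G i) y by rewrite -TG.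
  exists (maxn n k) => //; split => /=.
    by move: x Fx; exact/subsetPset/ndF/leq_maxl.
  by move: y Gy; exact/subsetPset/ndG/leq_maxr.
move=> n; have [mF Fn] := Foo n; have [mG Gn] := Goo n; split.
  by rewrite -[X in measurable X]setTI; apply: muncons => //; exact: measurableX.
rewrite /pushforward (_ : _ @^-1` _ = F n `*` G n); last first.
  by rewrite -comp_preimage (_ : uncons \o _ = id) ?preimage_id//; exact/funext.
by rewrite product_measure1E// lte_mul_pinfty// ge0_fin_numE.
Qed.

Section step.
Variables (d : nat) (m : {sigma_finite_measure set 'rV[R]_d -> \bar R}).

Definition lebesgue_rV_step : set 'rV[R]_d.+1 -> \bar R :=
  pushforward (@lebesgue_measure R \x m)%E (@cons_row d).

Let step_measure : {measure set 'rV[R]_d.+1 -> \bar R} :=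
  measure_function_pushforward__canonical__measure_function_Measure
    (@lebesgue_measure R \x m)%E (@measurable_row_cons R d).

HB.instance Definition _ := isMeasure.Build _ _ _ lebesgue_rV_step
  (measure0 step_measure) (measure_ge0 step_measure)
  (@measure_semi_sigma_additive _ _ _ step_measure).

HB.instance Definition _ := @Measure_isSigmaFinite.Build _ _ _ lebesgue_rV_step
  (@pushforward_cons_sigma_finite d m).

#[local] Lemma exists_step : exists m' : {sigma_finite_measure set 'rV[R]_d.+1 -> \bar R},
  pushforward (@lebesgue_measure R \x m)%E (@cons_row d) = m'.
Proof. by exists lebesgue_rV_step. Qed.

End step.

Let exists_sigma_finite_measure d :
  exists m : {sigma_finite_measure set 'rV[R]_d -> \bar R}, @lebesgue_rV R d = m.
Proof.
elim: d => [|d [m IH]]; first by exists \d_(0 : 'rV[R]_0).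
by have [m' m'E] := exists_step m; exists m'; rewrite /= IH.
Qed.

Let lebesgue_rV0 d : @lebesgue_rV R d set0 = 0%E.
Proof. by have [m ->] := exists_sigma_finite_measure d; rewrite measure0. Qed.

Let lebesgue_rV_ge0 d (A : set 'rV[R]_d) : (0 <= lebesgue_rV A)%E.
Proof. by have [m ->] := exists_sigma_finite_measure d; rewrite measure_ge0. Qed.

Let lebesgue_rV_semi_sigma_additive d : semi_sigma_additive (@lebesgue_rV R d).
Proof.
have [m ->] := exists_sigma_finite_measure d.
exact: measure_semi_sigma_additive.
Qed.

HB.instance Definition _ d := isMeasure.Build _ _ _ (@lebesgue_rV R d)
  (lebesgue_rV0 d) (@lebesgue_rV_ge0 d) (@lebesgue_rV_semi_sigma_additive d).

Let lebesgue_rV_sigma_finite d : sigma_finite setT (@lebesgue_rV R d).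
Proof. by have [m ->] := exists_sigma_finite_measure d; exact: sigma_finiteT. Qed.

HB.instance Definition _ d := @Measure_isSigmaFinite.Build _ _ _
  (@lebesgue_rV R d) (@lebesgue_rV_sigma_finite d).

Lemma lebesgue_rV_box d (A : 'I_d -> set R) : (forall i, measurable (A i)) ->
  lebesgue_rV [set x : 'rV[R]_d | forall i, A i (x 0 i)] =
  (\prod_(i < d) lebesgue_measure (A i))%E.
Proof.
elim: d => [|d IH] in A *; move=> mA.
  rewrite big_ord0 /= (_ : [set _ | _] = setT) ?diracT//.
  by apply/seteqP; split=> // x _ [].
rewrite big_ord_recl /= -IH//.
rewrite -product_measure1E; first last.
  rewrite (_ : [set x | _] = \bigcap_(i in [set: 'I_d]) (row_coord i @^-1` A (lift 0 i))).
    apply: fin_bigcap_measurable => [|i _]; first exact: finite_finset.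
    rewrite -[X in measurable X]setTI; apply: (measurable_row_coord i) => //; exact: mA.
  by apply/seteqP; split=> x /= xA i; [move=> _|]; exact: xA.
  exact: (mA ord0).
rewrite /pushforward; congr (_ _); apply/seteqP; split => -[x y] /=.
  move=> xyA; split; first by have := xyA 0; rewrite (cons_row0 (x, y)).
  by move=> i; have := xyA (lift 0 i); rewrite (cons_rowS (x, y)).
move=> [xA yA] i; have [j ->|->] := unliftP 0 i.
  by rewrite (cons_rowS (x, y)); exact: yA.
by rewrite (cons_row0 (x, y)).
Qed.

End lebesgue_rV_measure.

Definition dotr {R : realType} {d : nat} (x y : 'rV[R]_d) : R :=
  \sum_(i < d) x 0 i * y 0 i.

Definition enorm {R : realType} {d : nat} (x : 'rV[R]_d) : R :=
  Num.sqrt (dotr x x).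

Definition unit_ball {R : realType} {d : nat} : set 'rV[R]_d :=
  [set x | enorm x <= 1].

Definition unit_sphere {R : realType} {d : nat} : set 'rV[R]_d :=
  [set x | enorm x = 1].

(* The volume of the unit ball, which is finite and equal to
   pi^(d/2) / Gamma(1 + d/2). *)
Definition kappa {R : realType} (d : nat) : R :=
  fine (lebesgue_rV (@unit_ball R d)).

Definition convex_hull {R : realType} {d : nat} (A : set 'rV[R]_d) :
  set 'rV[R]_d := smallest (@convex_set R 'rV[R]_d) A.

(* ereal_sup set0 = -oo, so the support function of the empty set is -oo. *)
Definition support_function {R : realType} {d : nat} (K : set 'rV[R]_d)
  (u : 'rV[R]_d) : \bar R := ereal_sup [set (dotr u x)%:E | x in K].

Section poisson_process.
Context {R : realType} {dp : measure_display} {Omega : measurableType dp}.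
Variable P : probability Omega R.

Definition mutually_independent {n : nat} (N : 'I_n -> Omega -> \bar R) :=
  forall A : 'I_n -> set (\bar R), (forall i, measurable (A i)) ->
  P (\bigcap_i (N i @^-1` A i)) = (\prod_(i < n) P (N i @^-1` A i))%E.

(* Poisson law with mean m in [0, +oo]; the laws of mean 0 and +oo are the Dirac
   masses at 0 and +oo.  The library's poisson_pmf is not used because it is
   constantly 1 at rate 0. *)
Definition poisson_law (m : \bar R) (N : Omega -> \bar R) : Prop :=
  match m with
  | r%:E => forall k : nat,
      P (N @^-1` [set k%:R%:E]) = (expR (- r) * r ^+ k / k`!%:R)%:E
  | _ => P (N @^-1` [set +oo%E]) = 1%E
  end.

Context {d : nat}.

Definition point_count (X : Omega -> set 'rV[R]_d) (B : set 'rV[R]_d)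
  (w : Omega) : \bar R := counting (X w `&` B).

(* A homogeneous Poisson process is almost surely simple, so it is given by the
   random set of its points. *)
Record poisson_process (lambda : R) (X : Omega -> set 'rV[R]_d) : Prop := {
  poisson_locally_finite : forall w C, compact C -> finite_set (X w `&` C) ;
  poisson_measurable : forall B, measurable B ->
    measurable_fun setT (point_count X B) ;
  poisson_count : forall B, measurable B ->
    poisson_law (lambda%:E * lebesgue_rV B)%E (point_count X B) ;
  poisson_independent : forall n (B : 'I_n -> set 'rV[R]_d),
    (forall i, measurable (B i)) -> trivIset setT B ->
    mutually_independent (fun i => point_count X (B i)) }.

Definition poisson_polytope (X : Omega -> set 'rV[R]_d) (w : Omega) :
  set 'rV[R]_d := convex_hull (X w `&` unit_ball).

End poisson_process.

Definition cvg_in_probability {R : realType} {dp : measure_display}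
    {Omega : measurableType dp} (P : probability Omega R)
    (Y : nat -> Omega -> \bar R) (c : R) : Prop :=
  forall e : R, 0 < e ->
    P [set w | (e%:E < `|Y n w - c%:E|)%E] @[n --> \oo] --> 0%E.

(* Main.v *)
(* For the Poisson process, P(h <= t) = exp(- lambda vol(C_t)), where C_t is the
   cap {x in B : <u, x> > t}, so everything reduces to estimates of vol(C_t).
   Sandwiching C_t between cylinders with axis u gives, up to polynomial factors
   in d, vol(C_t) ~ kappa_d (1 - t) (1 - t^2)^((d-1)/2); the polynomial factor
   sqrt d that is needed when ln(lambda kappa_d) = o(d) comes from
   kappa_d <= 8 kappa_(d-1) / sqrt d, which holds because the slab
   |<u, x>| <= 2 / sqrt d contains at least half of the ball.  In each of the
   three regimes lambda vol(C_t) tends to +oo just below the claimed level and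
   to 0 just above it. *)

Require Import Defs.
From HB Require Import structures.
From mathcomp Require Import all_boot all_order all_algebra.
From mathcomp Require Import all_classical all_reals all_analysis.
From mathcomp Require Import measurable_realfun.
From mathcomp Require Import ring lra.

Import Order.TTheory GRing.Theory Num.Theory.
Import numFieldNormedType.Exports.

Local Open Scope classical_set_scope.
Local Open Scope ring_scope.

(** Lebesgue measure is built one coordinate at a time, so cylinders are measured along the first
    axis [e1] and invariance under rotations is not visible. It comes from the uniqueness of
    translation-invariant measures: a Householder reflection pushes Lebesgue measure to a
    translation-invariant measure giving the unit ball the same volume. This comparison needs
    [0 < kappa d], which is therefore proved with caps of axis [e1] alone.

    The closed formula for [kappa] never enters; inequalities between consecutive values suffice.

    The regimes call for different upper bounds. When [x = 0], [ln (lambda d * kappa d)] may grow as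
    slowly as [ln d], so no polynomial factor may be lost, and the cap is enclosed in a ball. When
    [x = +oo], the factor [1 - t] tends to 0 at an unknown speed and cannot be dropped, so the cap
    is enclosed in a cylinder; the polynomial loss is then harmless, because a relative change of
    [1 - t] changes the volume by a factor exponential in [d]. *)

Section dot_product.
Context {R : realType} {d : nat}.
Implicit Types (x y z v : 'rV[R]_d) (a t : R).

Lemma dotrC x y : dotr x y = dotr y x.
Proof. by apply: eq_bigr => i _; rewrite mulrC. Qed.

Lemma dotrDl x y z : dotr (x + y) z = dotr x z + dotr y z.
Proof. by rewrite -big_split; apply: eq_bigr => i _; rewrite mxE mulrDl. Qed.

Lemma dotrZl a x y : dotr (a *: x) y = a * dotr x y.
Proof. by rewrite mulr_sumr; apply: eq_bigr => i _; rewrite mxE mulrA. Qed.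

Lemma dotrDr x y z : dotr x (y + z) = dotr x y + dotr x z.
Proof. by rewrite dotrC dotrDl !(dotrC x). Qed.

Lemma dotrZr a x y : dotr x (a *: y) = a * dotr x y.
Proof. by rewrite dotrC dotrZl dotrC. Qed.

Lemma dotrNl x y : dotr (- x) y = - dotr x y.
Proof. by rewrite -scaleN1r dotrZl mulN1r. Qed.

Lemma dotrNr x y : dotr x (- y) = - dotr x y.
Proof. by rewrite dotrC dotrNl dotrC. Qed.

Lemma dotr_ge0 x : 0 <= dotr x x.
Proof. by apply: sumr_ge0 => i _; rewrite -expr2 sqr_ge0. Qed.

Lemma dotr_eq0 x : dotr x x = 0 -> x = 0.
Proof.
move=> x0; apply/rowP => i; rewrite mxE; apply/eqP; rewrite -sqrf_eq0 expr2.
have x2_ge0 (j : 'I_d) : true -> 0 <= x 0 j * x 0 j by rewrite -expr2 sqr_ge0.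
exact/eqP/(psumr_eq0P x2_ge0 x0).
Qed.

Lemma enorm_le a x : 0 <= a -> (enorm x <= a) = (dotr x x <= a ^+ 2).
Proof.
move=> a0; rewrite -(sqr_sqrtr (dotr_ge0 x)) -/(enorm x).
by rewrite ler_sqr// nnegrE ?sqrtr_ge0.
Qed.

Lemma unit_sphereE x : unit_sphere x -> dotr x x = 1.
Proof.
by rewrite /unit_sphere/= => x1; rewrite -(sqr_sqrtr (dotr_ge0 x)) -/(enorm x) x1 expr1n.
Qed.

Lemma unit_ballE x : unit_ball x <-> dotr x x <= 1.
Proof. by rewrite /unit_ball/= enorm_le// expr1n. Qed.

Lemma measurable_dotr v : measurable_fun [set: 'rV[R]_d] (dotr v).
Proof.
apply: measurable_sum => i; apply: measurable_funM => //.
exact: measurable_row_coord.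
Qed.

Lemma measurable_dotrr : measurable_fun [set: 'rV[R]_d] (fun x => dotr x x).
Proof.
by apply: measurable_sum => i; apply: measurable_funM => //;
  exact: measurable_row_coord.
Qed.

End dot_product.

(** * Balls, caps and their measurability *)

Definition eball {R : realType} {d : nat} (r : R) : set 'rV[R]_d :=
  [set x | dotr x x <= r ^+ 2].

Definition cap {R : realType} {d : nat} (u : 'rV[R]_d) (t : R) : set 'rV[R]_d :=
  unit_ball `&` [set x | t < dotr u x].

Section measurability.
Context {R : realType} {d : nat}.

Lemma unit_ball_eball : unit_ball = eball 1 :> set 'rV[R]_d.
Proof. by apply/seteqP; split=> x /=; rewrite /eball/= expr1n => /unit_ballE. Qed.

Lemma measurable_eball (r : R) : measurable (eball r : set 'rV[R]_d).
Proof.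
rewrite -[eball r]setTI.
rewrite [eball r](_ : _ = (fun x : 'rV[R]_d => dotr x x) @^-1` `]-oo, r ^+ 2]).
  by apply: measurable_dotrr.
by apply/seteqP; split => x; rewrite /eball /= in_itv.
Qed.

Lemma measurable_unit_ball : measurable (unit_ball : set 'rV[R]_d).
Proof. by rewrite unit_ball_eball; exact: measurable_eball. Qed.

Lemma measurable_halfspace (v : 'rV[R]_d) t : measurable [set x | t < dotr v x].
Proof.
rewrite -[X in measurable X]setTI.
rewrite (_ : [set x | _] = dotr v @^-1` `]t, +oo[); first exact: measurable_dotr.
by apply/seteqP; split => x; rewrite /= in_itv/= andbT.
Qed.

Lemma measurable_cap (v : 'rV[R]_d) t : measurable (cap v t).
Proof. exact: measurableI measurable_unit_ball (measurable_halfspace v t). Qed.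

Lemma measurable_affine (r : R) (v : 'rV[R]_d) :
  measurable_fun setT (fun x : 'rV[R]_d => r *: x + v : 'rV[R]_d).
Proof.
apply: measurable_fun_rowP => i.
rewrite (_ : _ \o _ = (fun x : 'rV[R]_d => r * row_coord i x + v 0 i)).
  apply: measurable_funD => //; apply: measurable_funM => //.
  exact: measurable_row_coord.
by apply/funext => x; rewrite /row_coord/= !mxE.
Qed.

End measurability.

(** * Lebesgue measure under homotheties and translations *)

Section affine_change_of_variable.
Context {R : realType}.

(** The left side is a measure in [A], so by uniqueness it only has to be compared with interval
    length on half-open intervals. *)
Lemma lebesgue_measure_affine (r v : R) (A : set R) : 0 < r -> measurable A ->
  (r%:E * lebesgue_measure ((fun x => (r * x + v)%R) @^-1` A) = lebesgue_measure A)%E.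
Proof.
move=> r0 mA.
have mf : measurable_fun [set: measurableTypeR R] ((fun x => r * x + v) : R -> measurableTypeR R).
  by apply: measurable_funD => //; apply: measurable_funM.
pose pf := measure_function_pushforward__canonical__measure_function_Measure
    (@lebesgue_measure R) mf.
pose m' : {measure set (measurableTypeR R) -> \bar R} := mscale (NngNum (ltW r0)) pf.
rewrite -[LHS]/(m' A); apply/esym/lebesgue_measure_unique => // _ [[a b] _ <-].
rewrite -[RHS]/(r%:E * lebesgue_measure
  ((fun x : R => (r * x + v)%R) @^-1` `]a, b]%classic))%E.
rewrite (_ : _ @^-1` _ = `](a - v) / r, (b - v) / r]%classic); last first.
  by apply/seteqP; split => y;
    rewrite /= !in_itv/= ltr_pdivrMr// ler_pdivlMr// ltrBlDr lerBrDr (mulrC y).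
rewrite !lebesgue_measure_itv/= !lte_fin ltr_pM2r ?invr_gt0// ltrD2r.
case: ifPn => _; rewrite ?mule0// -EFinB -EFinM; congr EFin.
rewrite -mulrBl mulrCA divff ?gt_eqF// mulr1; ring.
Qed.

End affine_change_of_variable.

Section cons_rV.
Context {R : realType} {d : nat}.

Definition cons_rV (p : R * 'rV[R]_d) : 'rV[R]_d.+1 := row_mx p.1%:M p.2.

Lemma cons_rV0 p : cons_rV p 0 0 = p.1.
Proof.
rewrite /cons_rV; have -> : 0 = lshift d 0 :> 'I_(1 + d) by exact: val_inj.
by apply: etrans; [exact: row_mxEl|rewrite mxE mulr1n].
Qed.

Lemma cons_rVS p (i : 'I_d) : cons_rV p 0 (lift 0 i) = p.2 0 i.
Proof.
rewrite /cons_rV.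
have -> : lift 0 i = rshift 1 i :> 'I_(1 + d) by exact: val_inj.
exact: row_mxEr.
Qed.

Lemma dotr_cons p q : dotr (cons_rV p) (cons_rV q) = p.1 * q.1 + dotr p.2 q.2.
Proof.
rewrite /dotr big_ord_recl !cons_rV0; congr (_ + _).
by apply: eq_bigr => i _; rewrite !cons_rVS.
Qed.

Lemma lebesgue_rV_cons (A : set 'rV[R]_d.+1) :
  lebesgue_rV A = (@lebesgue_measure R \x @lebesgue_rV R d)%E (cons_rV @^-1` A).
Proof. by []. Qed.

End cons_rV.

(** The map acts coordinatewise, hence passes through [cons_rV] ([gE]). On rectangles the identity
    is the one-dimensional case times the induction hypothesis, and a product measure is determined
    by its values there. *)
Lemma lebesgue_rV_affine {R : realType} {d : nat} (r : R) (v : 'rV[R]_d) A :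
  0 < r -> measurable A ->
  ((r ^+ d)%:E * lebesgue_rV ((fun x => (r *: x + v)%R) @^-1` A)
    = lebesgue_rV A)%E.
Proof.
move=> r0; elim: d => [|d IH] in v A *; move=> mA.
  rewrite expr0 mul1e; congr (lebesgue_rV _).
  by apply/seteqP; split=> x /=; rewrite [_ + _]thinmx0 (thinmx0 x).
pose v' : 'rV[R]_d := \row_i v 0 (lift 0 i).
pose g (p : measurableTypeR R * 'rV[R]_d) : measurableTypeR R * 'rV[R]_d := (r * p.1 + v 0 0, r *: p.2 + v').
have gE p : r *: cons_rV p + v = cons_rV (g p).
  apply/rowP => i; rewrite mxE [X in X + _]mxE; have [j ->|->] := unliftP 0 i.
    by rewrite !cons_rVS /= !mxE.
  by rewrite !cons_rV0.
have mg : measurable_fun setT g.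
  apply/measurable_fun_pairP; split => /=.
    by apply: measurable_funD => //; apply: measurable_funM.
  exact: (measurableT_comp (measurable_affine r v')).
pose pf := measure_function_pushforward__canonical__measure_function_Measure
    (@lebesgue_measure R \x @lebesgue_rV R d)%E mg.
have rd0 : 0 <= r ^+ d.+1 by rewrite exprn_ge0// ltW.
pose m : {measure set (measurableTypeR R * 'rV[R]_d) -> \bar R} := mscale (NngNum rd0) pf.
rewrite !lebesgue_rV_cons.
rewrite (_ : cons_rV @^-1` _ = g @^-1` (cons_rV @^-1` A)); last first.
  by apply/seteqP; split => p /=; rewrite gE.
rewrite -[LHS]/(m (cons_rV @^-1` A)); apply/esym.
apply: (@product_measure_unique _ _ _ _ _ (@lebesgue_measure R) (@lebesgue_rV R d) m); last first.
  by rewrite -[X in measurable X]setTI; exact: measurable_row_cons.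
move=> B C mB mC.
rewrite -[LHS]/((r ^+ d.+1)%:E * (@lebesgue_measure R \x @lebesgue_rV R d)
  (((fun x : R => (r * x + v 0%R 0%R)%R) @^-1` B)
   `*` ((fun x => (r *: x + v')%R) @^-1` C)))%E.
rewrite product_measure1E.
- rewrite exprS EFinM muleACA IH// lebesgue_measure_affine//.
- rewrite -[X in measurable X]setTI.
  have : measurable_fun [set: R] (fun x => r * x + v 0 0).
    by apply: measurable_funD => //; apply: measurable_funM.
  exact.
- rewrite -[X in measurable X]setTI; exact: measurable_affine.
Qed.

Lemma measurable_rVD {R : realType} {d : nat} :
  measurable_fun setT (fun p : 'rV[R]_d * 'rV[R]_d => p.1 + p.2 : 'rV[R]_d).
Proof.
apply: measurable_fun_rowP => i.
rewrite (_ : _ \o _ = (fun p => row_coord i p.1 + row_coord i p.2)).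
  by apply: measurable_funD; apply: measurableT_comp => //; exact: measurable_row_coord.
by apply/funext => p; rewrite /row_coord/= !mxE.
Qed.

Lemma measurable_rVB {R : realType} {d : nat} :
  measurable_fun setT (fun p : 'rV[R]_d * 'rV[R]_d => p.2 - p.1 : 'rV[R]_d).
Proof.
apply: measurable_fun_rowP => i.
rewrite (_ : _ \o _ = (fun p => row_coord i p.2 - row_coord i p.1)).
  by apply: measurable_funB; apply: measurableT_comp => //; exact: measurable_row_coord.
by apply/funext => p; rewrite /row_coord/= !mxE.
Qed.

(** * Uniqueness of translation-invariant measures up to a factor *)

Section translation_invariance.
Context {R : realType} {d : nat}.
Local Notation V := 'rV[R]_d.
Local Open Scope ereal_scope.

Definition translation_invariant (nu : set V -> \bar R) :=
  forall (v : V) (A : set V), measurable A -> nu [set x | A (x + v)%R] = nu A.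

Lemma lebesgue_rV_translation_invariant : translation_invariant (@lebesgue_rV R d).
Proof.
move=> v A mA; rewrite -[RHS](lebesgue_rV_affine 1 v A ltr01)// expr1n mul1e.
by congr (lebesgue_rV _); apply/seteqP; split => x /=; rewrite scale1r.
Qed.

(* Integrate [1_A(x) 1_B(y - x)] in both orders, substituting [x + y] for [x]. *)
Lemma translation_invariant_proportional
    (mu nu : {sigma_finite_measure set V -> \bar R}) (A B : set V) :
  translation_invariant mu -> translation_invariant nu ->
  measurable A -> measurable B -> (forall x, B x -> B (- x)%R) ->
  mu A * nu B = mu B * nu A.
Proof.
move=> muT nuT mA mB BN.
have m_pre (f : V * V -> V) C : measurable_fun setT f -> measurable C ->
    measurable (f @^-1` C).
  by move=> mf mC; rewrite -[X in measurable X]setTI; exact: mf.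
pose E1 := (fst @^-1` A) `&` ((fun p : V * V => (p.2 - p.1)%R) @^-1` B).
pose E2 := (fst @^-1` B) `&` ((fun p : V * V => (p.1 + p.2)%R) @^-1` A).
have mE1 : measurable E1.
  by apply: measurableI; apply: m_pre => //; exact: measurable_rVB.
have mE2 : measurable E2.
  by apply: measurableI; apply: m_pre => //; exact: measurable_rVD.
(* Tonelli for the indicator of [E]: both orders of integrating its sections give the same product
   measure. *)
have prodC E : measurable E -> (mu \x nu) E = (mu \x^ nu) E.
  move=> mE; apply: product_measure_unique => // C D mC mD.
  exact: product_measure2E.
rewrite -(product_measure1E mu nu)// -(product_measure1E mu nu)//.
have -> : (mu \x nu) (A `*` B) = (mu \x nu) E1.
  apply: eq_integral => x _ /=.
  rewrite -(nuT (- x)%R (xsection (A `*` B) x)); last first.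
    by apply: measurable_xsection; exact: measurableX.
  by congr (nu _); apply/seteqP; split => y; rewrite /xsection/= !inE.
have -> : (mu \x nu) (B `*` A) = (mu \x nu) E2.
  apply: eq_integral => x _ /=.
  rewrite -(nuT x (xsection (B `*` A) x)); last first.
    by apply: measurable_xsection; exact: measurableX.
  by congr (nu _); apply/seteqP; split => y; rewrite /xsection/= !inE /E2/= addrC.
rewrite !prodC//; apply: eq_integral => y _ /=.
rewrite -(muT y (ysection E1 y)); last exact: measurable_ysection.
(* The substitution turns [y - (x + y)] into [- x]; this is where the symmetry of [B] enters. *)
congr (mu _); apply/seteqP; split => x;
  rewrite /ysection/= !inE /E1 /E2/= opprD addrCA subrr addr0 => -[].
  by move=> Axy /BN; rewrite opprK.
by move=> /BN.
Qed.

End translation_invariance.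

(** * Cylinders with axis [e1], and finiteness of the volume of the ball *)

Section ball_volume.
Context {R : realType}.
Local Notation e1 := (cons_rV (1, 0)).

Lemma dotr_e1 d (p : R * 'rV[R]_d) : dotr e1 (cons_rV p) = p.1.
Proof. by rewrite dotr_cons mul1r (_ : dotr 0 _ = 0) ?addr0// -(scale0r 0) dotrZl mul0r. Qed.

Lemma unit_sphere_e1 d : unit_sphere (e1 : 'rV[R]_d.+1).
Proof.
rewrite /unit_sphere/= /enorm dotr_cons mulr1.
by rewrite (_ : dotr 0 _ = 0) ?addr0 ?sqrtr1// -(scale0r 0) dotrZl mul0r.
Qed.

Lemma le_lebesgue_rV_rect d (A : set 'rV[R]_d.+1) (I : set R) (B : set 'rV[R]_d) :
  measurable A -> measurable I -> measurable B ->
  (forall p, A (cons_rV p) -> I p.1 /\ B p.2) ->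
  (lebesgue_rV A <= lebesgue_measure I * lebesgue_rV B)%E.
Proof.
move=> mA mI mB AIB.
rewrite -(product_measure1E (@lebesgue_measure R) (@lebesgue_rV R d))//.
rewrite lebesgue_rV_cons; apply: le_measure; rewrite ?inE.
- by rewrite -[X in measurable X]setTI; exact: measurable_row_cons.
- exact: measurableX.
- by move=> p /AIB[].
Qed.

Lemma ge_lebesgue_rV_rect d (A : set 'rV[R]_d.+1) (I : set R) (B : set 'rV[R]_d) :
  measurable A -> measurable I -> measurable B ->
  (forall p, I p.1 -> B p.2 -> A (cons_rV p)) ->
  (lebesgue_measure I * lebesgue_rV B <= lebesgue_rV A)%E.
Proof.
move=> mA mI mB IBA.
rewrite -(product_measure1E (@lebesgue_measure R) (@lebesgue_rV R d))//.
rewrite lebesgue_rV_cons; apply: le_measure; rewrite ?inE.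
- exact: measurableX.
- by rewrite -[X in measurable X]setTI; exact: measurable_row_cons.
- by move=> p []; exact: IBA.
Qed.

Lemma cons_rV_eta {d} (x : 'rV[R]_d.+1) :
  x = cons_rV (x 0 0, \row_i x 0 (lift 0 i)).
Proof.
apply/rowP => i; have [j ->|->] := unliftP 0 i; last by rewrite cons_rV0.
by rewrite cons_rVS mxE.
Qed.

Lemma unit_ball_cons d (p : R * 'rV[R]_d) :
  unit_ball (cons_rV p) <-> p.1 ^+ 2 + dotr p.2 p.2 <= 1.
Proof. by rewrite -dotr_cons; exact: unit_ballE. Qed.

Definition slab d (t : R) : set 'rV[R]_d.+1 :=
  unit_ball `&` [set x | - t <= dotr e1 x <= t].

Lemma measurable_slab d t : measurable (slab d t).
Proof.
apply: measurableI; first exact: measurable_unit_ball.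
rewrite -[X in measurable X]setTI.
rewrite (_ : [set x | _] = dotr e1 @^-1` `[- t, t]); first exact: measurable_dotr.
by apply/seteqP; split => x; rewrite /= in_itv.
Qed.

Lemma lebesgue_rV_slab_le d (t : R) : 0 <= t ->
  (lebesgue_rV (slab d t) <= (2 * t)%:E * lebesgue_rV (@unit_ball R d))%E.
Proof.
move=> t0.
have := @le_lebesgue_rV_rect d (slab d t) `[- t, t]%classic unit_ball.
rewrite lebesgue_measure_itv/= lte_fin.
have -> : (if (- t < t)%R then t%:E - (- t)%:E else 0)%E = (2 * t)%:E.
  case: ltP => [_|]; first by rewrite -EFinB; congr EFin; ring.
  by move=> tt; congr EFin; lra.
apply => //; first exact: measurable_slab; first exact: measurable_unit_ball.
move=> p [/unit_ball_cons p1 /=]; rewrite dotr_e1 in_itv/= => -> ; split => //.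
by apply/unit_ballE; have := sqr_ge0 p.1; lra.
Qed.

(** The ball is its own slab of half-width 1, hence lies in a cylinder of height 2 over the ball one
    dimension lower. Finiteness makes the [fine] in [kappa] harmless. *)
Lemma lebesgue_rV_unit_ball_lty d : (lebesgue_rV (@unit_ball R d) < +oo)%E.
Proof.
elim: d => [|d IH].
  rewrite /lebesgue_rV diracE; case: (_ \in _) => //; exact: ltry.
have -> : @unit_ball R d.+1 = slab d 1.
  apply/seteqP; split=> x; last by case.
  move=> x1; split=> //=; move: x1.
  rewrite (cons_rV_eta x) dotr_e1 => /unit_ball_cons/=.
  have := dotr_ge0 (\row_i x 0 (lift 0 i) : 'rV[R]_d).
  by move=> h0 h1; rewrite -ler_norml -(@ler_pXn2r _ 2)// ?nnegrE// expr1n real_normK ?num_real//; lra.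
apply: le_lt_trans (lebesgue_rV_slab_le d 1 ler01) _.
by rewrite lte_mul_pinfty// ?lee_fin//; lra.
Qed.

Lemma kappaE d : lebesgue_rV (@unit_ball R d) = (kappa d)%:E.
Proof.
by rewrite /kappa fineK// ge0_fin_numE ?measure_ge0// lebesgue_rV_unit_ball_lty.
Qed.

Lemma kappa_ge0 d : 0 <= kappa d :> R.
Proof. by rewrite -lee_fin -kappaE measure_ge0. Qed.

Lemma lebesgue_rV_ball d (c : 'rV[R]_d) r : 0 < r ->
  lebesgue_rV [set x | dotr (x - c) (x - c) <= r ^+ 2] = (r ^+ d * kappa d)%:E.
Proof.
move=> r0; rewrite -(lebesgue_rV_affine r c)//.
  rewrite EFinM -kappaE; congr (_ * lebesgue_rV _)%E.
  apply/seteqP; split=> x /=; rewrite addrK dotrZl dotrZr mulrA -expr2;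
    rewrite ger_pMr ?exprn_gt0//.
    by move=> ?; apply/unit_ballE.
  by move=> /unit_ballE.
rewrite (_ : [set x | _] = (fun x : 'rV[R]_d => 1 *: x + (- c)) @^-1` eball r).
  rewrite -[X in measurable X]setTI; apply: measurable_affine => //.
  exact: measurable_eball.
by apply/seteqP; split => x; rewrite /eball/= scale1r.
Qed.

Lemma lebesgue_rV_eball d r : 0 < r ->
  lebesgue_rV (eball r : set 'rV[R]_d) = (r ^+ d * kappa d)%:E.
Proof.
move=> /(lebesgue_rV_ball d 0) <-; congr lebesgue_rV.
by apply/seteqP; split=> x; rewrite /eball/= subr0.
Qed.

End ball_volume.

(** * Invariance of Lebesgue measure under reflections *)

Section reflection.
Context {R : realType} {d : nat}.
Implicit Types u w x y : 'rV[R]_d.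

(* Householder reflection exchanging the unit vectors [u] and [w]; it is the
   identity when [u = w] since then [0^-1 = 0]. *)
Definition reflection u w x : 'rV[R]_d :=
  x - (2 * dotr x (u - w) / dotr (u - w) (u - w)) *: (u - w).

Variables (u w : 'rV[R]_d).
Hypotheses (u1 : unit_sphere u) (w1 : unit_sphere w).
Local Notation f := (reflection u w).

Lemma dotr_reflection x y : dotr (f x) (f y) = dotr x y.
Proof.
rewrite /reflection; move: (u - w) => v.
have [v0|v0] := eqVneq (dotr v v) 0; first by rewrite v0 invr0 !mulr0 !scale0r !subr0.
rewrite !(dotrDl, dotrDr, dotrNl, dotrNr, dotrZl, dotrZr) (dotrC v y).
by field.
Qed.

Lemma reflectionD x y : f (x + y) = f x + f y.
Proof.
rewrite /reflection dotrDl mulrDr mulrDl scalerDl opprD.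
by rewrite addrACA.
Qed.

Lemma reflectionK : involutive f.
Proof.
move=> x; rewrite /reflection; move: (u - w) => v.
have [v0|v0] := eqVneq (dotr v v) 0; first by rewrite v0 invr0 !mulr0 !scale0r !subr0.
rewrite dotrDl dotrNl dotrZl -addrA -opprD -scalerDl.
by rewrite [X in X *: v](_ : _ = 0) ?scale0r ?subr0//; field.
Qed.

Lemma reflection_swap : f w = u.
Proof.
rewrite /reflection; have [|uw] := eqVneq (dotr (u - w) (u - w)) 0.
  by move/dotr_eq0 => uw; rewrite uw scaler0 subr0; apply/esym/eqP; rewrite -subr_eq0 uw.
have E : dotr (u - w) (u - w) = - (2 * dotr w (u - w)).
  rewrite !(dotrDl, dotrDr, dotrNl, dotrNr) (dotrC u w) !unit_sphereE//; ring.
have -> : 2 * dotr w (u - w) / dotr (u - w) (u - w) = - 1.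
  by rewrite -[2 * _]opprK -E mulNr divff.
by rewrite scaleN1r opprK addrC subrK.
Qed.

Lemma measurable_reflection : measurable_fun setT f.
Proof.
apply: measurable_fun_rowP => i.
rewrite (_ : _ \o _ = (fun x : 'rV[R]_d => row_coord i x -
   (2 * dotr (u - w) x / dotr (u - w) (u - w)) * (u - w) 0 i)).
  apply: measurable_funB; first exact: measurable_row_coord.
  apply: measurable_funM => //; apply: measurable_funM => //.
  by apply: measurable_funM => //; exact: measurable_dotr.
by apply/funext => x; rewrite /row_coord/= mxE [X in _ + X]mxE [X in - X]mxE dotrC.
Qed.

End reflection.

Section reflection_invariance.
Context {R : realType} {d : nat}.
Local Notation V := 'rV[R]_d.
Variables (u w : V).
Local Notation f := (reflection u w).

Let nu : set V -> \bar R := pushforward (@lebesgue_rV R d) f.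

Let nu_measure : {measure set V -> \bar R} :=
  measure_function_pushforward__canonical__measure_function_Measure
    (@lebesgue_rV R d) (measurable_reflection u w).

HB.instance Definition _ := isMeasure.Build _ _ _ nu
  (measure0 nu_measure) (measure_ge0 nu_measure)
  (@measure_semi_sigma_additive _ _ _ nu_measure).

Let nu_eball r : nu (eball r) = lebesgue_rV (eball r : set V).
Proof.
by congr lebesgue_rV; apply/seteqP; split => x; rewrite /eball/= dotr_reflection.
Qed.

Let nu_sigma_finite : sigma_finite setT nu.
Proof.
exists (fun n => eball n.+1%:R).
  apply/esym/seteqP; split => // x _.
  exists (Num.trunc (dotr x x)) => //; rewrite /eball/=.
  have /ltW/le_trans := truncnS_gt (dotr x x); apply.
  by rewrite expr2 ler_peMl// ler1n.
move=> n; split; first exact: measurable_eball.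
by rewrite nu_eball lebesgue_rV_eball ?ltr0n// ltry.
Qed.

HB.instance Definition _ := @Measure_isSigmaFinite.Build _ _ _ nu nu_sigma_finite.

(** As [f] is additive and involutive, [nu] is translation invariant, hence proportional to Lebesgue
    measure. As [f] is an isometry, both give [kappa d] to the unit ball, and its positivity forces
    the factor to be 1. *)
Lemma lebesgue_rV_reflection A : 0 < kappa d :> R -> measurable A ->
  lebesgue_rV (f @^-1` A) = lebesgue_rV A.
Proof.
move=> k0 mA.
have nuT : translation_invariant nu.
  move=> v B mB; rewrite /nu /pushforward.
  rewrite -[RHS](lebesgue_rV_translation_invariant (f v))//; last first.
    rewrite -[X in measurable X]setTI; exact: measurable_reflection.
  by congr lebesgue_rV; apply/seteqP; split => x /=; rewrite reflectionD reflectionK.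
have eN : forall x : V, eball 1 x -> eball 1 (- x).
  by move=> x; rewrite /eball/= dotrNl dotrNr opprK.
have E : ((kappa d)%:E * lebesgue_rV A = (kappa d)%:E * lebesgue_rV (f @^-1` A))%E.
  rewrite -kappaE unit_ball_eball muleC -[X in (_ * X = _)%E](nu_eball 1).
  exact: (@translation_invariant_proportional R d (@lebesgue_rV R d) nu A (eball 1)
    lebesgue_rV_translation_invariant nuT mA (measurable_eball 1) eN).
apply/eqP; rewrite eq_le; apply/andP; split;
  by rewrite -(@lee_pmul2l _ (kappa d)%:E) ?lte_fin// E.
Qed.

End reflection_invariance.

(** * Volumes of caps, and comparison of consecutive ball volumes *)

Section cap_volume.
Context {R : realType}.
Local Notation e1 := (cons_rV (1, 0)).

Lemma bernoulli_inequality n (b : R) : 0 <= b <= 1 -> 1 - n%:R * b <= (1 - b) ^+ n.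
Proof.
move=> /andP[b0 b1]; elim: n => [|n IH]; first by rewrite mul0r subr0 expr0.
rewrite exprS; apply: le_trans (ler_wpM2l _ IH); last by rewrite subr_ge0.
have n0 : 0 <= n%:R :> R by [].
by rewrite -natr1; nra.
Qed.

Lemma cap_e1 d (t : R) (p : R * 'rV[R]_d) :
  cap e1 t (cons_rV p) <-> p.1 ^+ 2 + dotr p.2 p.2 <= 1 /\ t < p.1.
Proof. by rewrite /cap/= dotr_e1; split=> -[/unit_ball_cons]. Qed.

(** Between heights [t] and [t + a] the ball is narrowest at [t + a]; the cylinder with that radius
    lies in the cap. *)
Lemma cap_e1_ge d (t a : R) : 0 <= t -> 0 < a -> t + a < 1 ->
  ((a * Num.sqrt (1 - (t + a) ^+ 2) ^+ d * kappa d)%:E <=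
   lebesgue_rV (cap (e1 : 'rV[R]_d.+1) t))%E.
Proof.
move=> t0 a0 ta1; set s := Num.sqrt _.
have s2 : s ^+ 2 = 1 - (t + a) ^+ 2 by rewrite sqr_sqrtr//; nra.
have s0 : 0 < s by rewrite sqrtr_gt0; nra.
have := @ge_lebesgue_rV_rect R d (cap e1 t) `]t, t + a]%classic (eball s).
rewrite lebesgue_measure_itv/= lte_fin ltrDl a0 lebesgue_rV_eball// -EFinB.
rewrite (addrC t a) addrK -EFinM mulrA; apply => //; first exact: measurable_cap.
  exact: measurable_eball.
move=> p; rewrite in_itv/= /eball/= s2 => /andP[tp pa] p2; apply/cap_e1; split => //.
rewrite addrC in pa.
have : p.1 ^+ 2 <= (t + a) ^+ 2 by rewrite ler_sqr ?nnegrE//; lra.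
by lra.
Qed.

(** Above height [t] the ball is widest at [t]; the cylinder with that radius and height [1 - t]
    contains the cap. *)
Lemma cap_e1_le d (t : R) : 0 <= t < 1 ->
  (lebesgue_rV (cap (e1 : 'rV[R]_d.+1) t) <=
   ((1 - t) * Num.sqrt (1 - t ^+ 2) ^+ d * kappa d)%:E)%E.
Proof.
move=> /andP[t0 t1]; set s := Num.sqrt _.
have s2 : s ^+ 2 = 1 - t ^+ 2 by rewrite sqr_sqrtr//; nra.
have s0 : 0 < s by rewrite sqrtr_gt0; nra.
have := @le_lebesgue_rV_rect R d (cap e1 t) `]t, 1]%classic (eball s).
rewrite lebesgue_measure_itv/= lte_fin t1 lebesgue_rV_eball// -EFinB.
rewrite -EFinM mulrA; apply => //; first exact: measurable_cap.
  exact: measurable_eball.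
move=> p /cap_e1[p1 tp]; have p0 := dotr_ge0 p.2.
rewrite in_itv/= tp /eball/= s2; split; first nra.
have : t ^+ 2 <= p.1 ^+ 2 by rewrite ler_sqr ?nnegrE//; lra.
by lra.
Qed.

(** The upper half ball contains a cylinder of height [a = 1 / (d + 2)]. This height is small enough
    for Bernoulli's inequality to leave its base at least half of the volume [kappa d]:
    [1 - d * a^2 >= 1 - a * (1 - a) >= 1 / 2]. *)
Lemma kappa_le_kappaS d : kappa d <= 2 * d.+2%:R * kappa d.+1 :> R.
Proof.
have k0 := @kappa_ge0 R d.
pose a : R := d.+2%:R^-1.
have a0 : 0 < a by rewrite invr_gt0 ltr0n.
have da : d%:R * a <= 1 - a.
  by rewrite /a lerBrDr -{2}[_^-1]mul1r -mulrDl natr1 ler_pdivrMr ?ltr0n// mul1r ler_nat.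
have a12 : a <= 2^-1 by rewrite lef_pV2 ?posrE ?ltr0n// ler_nat.
have s1 : 2^-1 <= Num.sqrt (1 - a ^+ 2) ^+ d.
  apply: (@le_trans _ _ ((1 - a ^+ 2) ^+ d)); last first.
    have a2 : 0 <= 1 - a ^+ 2 by nra.
    have s1 : Num.sqrt (1 - a ^+ 2) <= 1 by rewrite -[leRHS]sqrtr1 ler_wsqrtr// gerBl sqr_ge0.
    rewrite lerXn2r ?nnegrE ?sqrtr_ge0// -[leLHS]sqr_sqrtr//.
    by rewrite expr2 ler_piMl ?sqrtr_ge0.
  apply: le_trans (_ : _ <= 1 - d%:R * a ^+ 2) _; first nra.
  by apply: bernoulli_inequality; rewrite sqr_ge0/=; nra.
have : ((a * Num.sqrt (1 - a ^+ 2) ^+ d * kappa d)%:E <= (kappa d.+1)%:E)%E.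
  rewrite -(kappaE d.+1).
  have := cap_e1_ge d 0 a; rewrite add0r => /(_ (lexx _) a0) H.
  apply: le_trans (H _) _; first lra.
  apply: le_measure; rewrite ?inE; [exact: measurable_cap|exact: measurable_unit_ball|].
  by move=> x [].
rewrite lee_fin => H.
have : a * (2^-1 * kappa d) <= kappa d.+1.
  by apply: le_trans H; rewrite -mulrA ler_pM2l// ler_wpM2r.
rewrite /a mulrA -invfM mulrC ler_pdivrMr ?mulr_gt0 ?ltr0n//.
by rewrite mulrC (mulrC 2).
Qed.

(** Rests on caps of axis [e1] only, so that it can serve as a premise of the reflection argument
    without circularity. *)
Lemma kappa_gt0 d : 0 < kappa d :> R.
Proof.
elim: d => [|d IH].
  rewrite -lte_fin -kappaE /= /lebesgue_rV diracE mem_set ?lte_fin//.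
  by apply/unit_ballE; rewrite /dotr big_ord0 ler01.
have := lt_le_trans IH (kappa_le_kappaS d).
by rewrite pmulr_rgt0// mulr_gt0// ltr0n.
Qed.

Lemma lebesgue_rV_cap d (u w : 'rV[R]_d) t : unit_sphere u -> unit_sphere w ->
  lebesgue_rV (cap u t) = lebesgue_rV (cap w t).
Proof.
move=> u1 w1; rewrite -(lebesgue_rV_reflection u w (cap u t)) ?kappa_gt0//; last first.
  exact: measurable_cap.
have dE x : dotr u (reflection u w x) = dotr w x.
  by rewrite -{1}(reflection_swap u w)// dotr_reflection.
congr lebesgue_rV; apply/seteqP; split => x [/unit_ballE xb] /=.
  by rewrite dE => tx; split => //; apply/unit_ballE; rewrite -(dotr_reflection u w).
by move=> tx; split; [apply/unit_ballE; rewrite dotr_reflection|rewrite /= dE].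
Qed.

Lemma cap_ge d (u : 'rV[R]_d.+1) (t a : R) : unit_sphere u ->
  0 <= t -> 0 < a -> t + a < 1 ->
  ((a * Num.sqrt (1 - (t + a) ^+ 2) ^+ d * kappa d)%:E <= lebesgue_rV (cap u t))%E.
Proof. by move=> u1; rewrite (lebesgue_rV_cap _ _ _ _ u1 (unit_sphere_e1 d)); exact: cap_e1_ge. Qed.

Lemma cap_le d (u : 'rV[R]_d.+1) (t : R) : unit_sphere u -> 0 <= t < 1 ->
  (lebesgue_rV (cap u t) <= ((1 - t) * Num.sqrt (1 - t ^+ 2) ^+ d * kappa d)%:E)%E.
Proof. by move=> u1; rewrite (lebesgue_rV_cap _ _ _ _ u1 (unit_sphere_e1 d)); exact: cap_e1_le. Qed.

(** Expanding [|x - u|^2 >= 0] gives [<u, x> <= 1] on the unit ball. *)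
Lemma cap_eq0 d (u : 'rV[R]_d) (t : R) : unit_sphere u -> 1 <= t -> cap u t = set0.
Proof.
move=> /unit_sphereE u1 t1; apply/seteqP; split => // x [/unit_ballE x1 /= tx].
have := dotr_ge0 (x - u).
rewrite !(dotrDl, dotrDr, dotrNl, dotrNr) (dotrC x u) u1.
by lra.
Qed.

(* The cap lies in the ball of radius [sqrt (1 - t^2)] centered at [t u]. *)
Lemma cap_le_ball d (u : 'rV[R]_d) (t : R) : unit_sphere u -> 0 <= t < 1 ->
  (lebesgue_rV (cap u t) <= (Num.sqrt (1 - t ^+ 2) ^+ d * kappa d)%:E)%E.
Proof.
move=> /unit_sphereE u1 /andP[t0 t1]; set s := Num.sqrt _.
have s2 : s ^+ 2 = 1 - t ^+ 2 by rewrite sqr_sqrtr//; nra.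
have s0 : 0 < s by rewrite sqrtr_gt0; nra.
rewrite -(lebesgue_rV_ball d (t *: u))//; apply: le_measure; rewrite ?inE.
- exact: measurable_cap.
- rewrite (_ : [set x | _] = (fun x : 'rV[R]_d => 1 *: x + (- (t *: u))) @^-1` eball s).
    rewrite -[X in measurable X]setTI; apply: measurable_affine => //.
    exact: measurable_eball.
  by apply/seteqP; split => x; rewrite /eball/= scale1r.
move=> x [/unit_ballE x1 /= tx].
rewrite !(dotrDl, dotrDr, dotrNl, dotrNr, dotrZl, dotrZr) (dotrC x u) u1 s2.
by nra.
Qed.

(** The ball bound together with [1 - t^2 <= exp (- t^2)]. Emptiness of the cap for [t >= 1] extends
    it to all [t >= 0], so it can be used at levels not known to be below 1. *)
Lemma cap_le_expR d (u : 'rV[R]_d) (t : R) : unit_sphere u -> 0 <= t ->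
  (lebesgue_rV (cap u t) <= (expR (- (t ^+ 2 * d%:R / 2)) * kappa d)%:E)%E.
Proof.
move=> u1 t0; have [t1|t1] := ltP t 1; last first.
  by rewrite cap_eq0// measure0 lee_fin mulr_ge0 ?expR_ge0 ?kappa_ge0.
apply: le_trans (cap_le_ball _ _ _ u1 _) _; first by rewrite t0.
rewrite lee_fin ler_wpM2r ?kappa_ge0//.
have -> : - (t ^+ 2 * d%:R / 2) = d%:R * (- (t ^+ 2) / 2) by ring.
rewrite expRM_natl lerXn2r ?nnegrE ?sqrtr_ge0 ?expR_ge0//.
rewrite -(@ler_pXn2r _ 2) ?nnegrE ?sqrtr_ge0 ?expR_ge0// sqr_sqrtr; last nra.
rewrite -expRM_natl mulrC divfK//; exact: expR_ge1Dx.
Qed.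

(** With this half-width [t] the exponent [t^2 * (d + 1) / 2] equals 2, and [exp (- 2) <= 1 / 4], so
    the two caps outside the slab take at most half of the ball. The slab lies in a cylinder of
    height [2 * t = 4 / sqrt (d + 1)], and doubling gives the 8. *)
Lemma kappaS_le_kappa d : kappa d.+1 <= 8 / Num.sqrt d.+1%:R * kappa d :> R.
Proof.
pose t : R := 2 / Num.sqrt d.+1%:R.
have t0 : 0 <= t by rewrite divr_ge0 ?sqrtr_ge0.
have capt (u : 'rV[R]_d.+1) : unit_sphere u ->
    (lebesgue_rV (cap u t) <= (4^-1 * kappa d.+1)%:E)%E.
  move=> u1; apply: le_trans (cap_le_expR _ _ _ u1 t0) _.
  rewrite lee_fin ler_wpM2r ?kappa_ge0//.
  have -> : t ^+ 2 * d.+1%:R / 2 = 2%:R * 1.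
    rewrite /t expr_div_n sqr_sqrtr ?ler0n//; field.
    by rewrite ?addr_eq0 gt_eqF//; rewrite ltr_pwDl// ?ltr01// ler0n.
  rewrite expRN lef_pV2 ?posrE ?expR_gt0// expRM_natl.
  have := @expR_ge1Dx R 1; have := expR_gt0 (1 : R); nra.
have m1 : unit_sphere (- e1 : 'rV[R]_d.+1).
  by have := unit_sphere_e1 d; rewrite /unit_sphere/= /enorm dotrNl dotrNr opprK; exact.
have : ((kappa d.+1)%:E <=
    lebesgue_rV (slab d t) + (lebesgue_rV (cap (e1 : 'rV[R]_d.+1) t)
    + lebesgue_rV (cap (- e1 : 'rV[R]_d.+1) t)))%E.
  rewrite -kappaE.
  apply: le_trans (_ : _ <= lebesgue_rV (slab d t `|` (cap (e1 : 'rV[R]_d.+1) t `|` cap (- e1) t)))%E _.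
    apply: le_measure; rewrite ?inE; first exact: measurable_unit_ball.
      by apply: measurableU; [exact: measurable_slab|apply: measurableU; exact: measurable_cap].
    move=> x x1; rewrite /slab /cap/= dotrNl.
    case: (ltP t (dotr e1 x)) => h1; first by right; left.
    case: (ltP t (- dotr e1 x)) => h2; first by right; right.
    by left; split => //=; apply/andP; split => //; rewrite lerNl.
  apply: le_trans (measureU2 _ _ _) _; [exact: measurable_slab|by apply: measurableU; exact: measurable_cap|].
  by rewrite leeD2l// measureU2//; exact: measurable_cap.
move=> /le_trans/(_ (leeD (lebesgue_rV_slab_le d t t0) (leeD (capt _ (unit_sphere_e1 d)) (capt _ m1)))).
rewrite kappaE -EFinM -!EFinD lee_fin.
by rewrite /t -!mulrA; lra.
Qed.

End cap_volume.

(** * The law of the support function *)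

Section support_function_hull.
Context {R : realType} {d : nat}.

Lemma convex_halfspace (u : 'rV[R]_d) (t : R) :
  convex_set ([set x | dotr u x <= t] : set (convex_lmodType 'rV[R]_d)).
Proof.
move=> x y l; rewrite !inE /= => xt yt.
rewrite /conv /= dotrDr !dotrZr.
have l0 : 0 <= l%:num by []. have l1 : l%:num <= 1 by [].
have h0 : 0 <= 1 - l%:num by rewrite subr_ge0.
rewrite [leRHS](_ : t = l%:num * t + (1 - l%:num) * t); last by ring.
by apply: lerD; apply: ler_wpM2l.
Qed.

(** A half-space is convex, so it contains the hull as soon as it contains [A]. The value [-oo] for
    empty [A] agrees with the vacuous right side. *)
Lemma support_function_hull_le (A : set 'rV[R]_d) (u : 'rV[R]_d) (t : R) :
  (support_function (convex_hull A) u <= t%:E)%E <->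
  forall x, A x -> dotr u x <= t.
Proof.
split=> [h x Ax|At].
  rewrite -lee_fin; apply: le_trans h; apply: ereal_sup_ubound; exists x => //.
  exact: sub_gen_smallest.
apply: ge_ereal_sup => _ [x hx <-]; rewrite lee_fin.
exact: (smallest_sub (convex_halfspace u t) At).
Qed.

End support_function_hull.

Lemma counting_eq0 {T : choiceType} {R : realType} (A : set T) :
  counting A = 0%:R%:E :> \bar R <-> A = set0.
Proof.
rewrite /counting; split=> [|->]; last by rewrite asboolT// fset_set0.
case: ifPn => // /asboolP fA [/eqP]; rewrite pnatr_eq0 => /eqP A0.
exact: fset_set_set0 fA (finmap.cardfs0_eq A0).
Qed.

Section poisson_support.
Context {R : realType} {dp : measure_display} {Omega : measurableType dp}.
Variable P : probability Omega R.
Context {d : nat}.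
Variables (lambda : R) (X : Omega -> set 'rV[R]_d) (u : 'rV[R]_d).
Hypothesis XP : poisson_process P lambda X.

Local Notation h := (fun w => support_function (poisson_polytope X w) u).

Definition cap_volume (t : R) : R := fine (lebesgue_rV (cap u t)).

(** Turns an event about the polytope into the vanishing of one Poisson count, which provides both
    its measurability and its probability. *)
Lemma support_leE (t : R) :
  [set w | (h w <= t%:E)%E] = point_count X (cap u t) @^-1` [set 0%:R%:E].
Proof.
apply/seteqP; split => w /=; rewrite /point_count.
  move=> /support_function_hull_le ht; apply/counting_eq0/seteqP; split => // x.
  by move=> [Xx [Bx /=]]; rewrite ltNge ht.
move=> /counting_eq0 X0; apply/support_function_hull_le => x [Xx Bx].
rewrite leNgt; apply/negP => tx.
suff : set0 x by []. by rewrite -X0.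
Qed.

Lemma measurable_support_le t : measurable [set w | (h w <= t%:E)%E].
Proof.
rewrite support_leE -[X in measurable X]setTI.
apply: (poisson_measurable XP (measurable_cap u t)) => //.
Qed.

Lemma measurable_support : measurable_fun setT h.
Proof.
move=> _; apply: (measurability _ (ErealGenOInfty.measurableE R)) => //.
move=> _ [_ [t ->] <-]; rewrite setTI.
rewrite (_ : _ @^-1` _ = ~` [set w | (h w <= t%:E)%E]).
  exact/measurableC/measurable_support_le.
apply/seteqP; split => w /=; rewrite in_itv/= andbT ltNge; first by move/negP.
by move/negP.
Qed.

Lemma cap_volume_fin t : lebesgue_rV (cap u t) = (cap_volume t)%:E.
Proof.
rewrite /cap_volume fineK// ge0_fin_numE//.
apply: le_lt_trans (lebesgue_rV_unit_ball_lty d).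
apply: le_measure; rewrite ?inE; [exact: measurable_cap|exact: measurable_unit_ball|].
by move=> x [].
Qed.

Lemma prob_support_le t :
  P [set w | (h w <= t%:E)%E] = (expR (- (lambda * cap_volume t)))%:E.
Proof.
rewrite support_leE.
have := poisson_count XP (measurable_cap u t).
rewrite cap_volume_fin -EFinM => /(_ 0%N) ->.
by rewrite expr0 fact0 mulr1 divr1.
Qed.

Lemma prob_support_gt t :
  P [set w | (t%:E < h w)%E] = (1 - expR (- (lambda * cap_volume t)))%:E.
Proof.
rewrite (_ : [set w | _] = ~` [set w | (h w <= t%:E)%E]).
  by rewrite probability_setC ?prob_support_le//; exact: measurable_support_le.
by apply/seteqP; split => w /=; rewrite ltNge => /negP.
Qed.

Lemma prob_support_dev (E : set Omega) (t1 t2 : R) : measurable E ->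
  (forall w, E w -> (h w <= t1%:E \/ t2%:E < h w)%E) ->
  (P E <= (expR (- (lambda * cap_volume t1)) +
     (1 - expR (- (lambda * cap_volume t2))))%:E)%E.
Proof.
move=> mE Et; rewrite EFinD -prob_support_le -prob_support_gt.
have m2 : measurable [set w | (t2%:E < h w)%E].
  rewrite (_ : [set w | _] = ~` [set w | (h w <= t2%:E)%E]).
    exact/measurableC/measurable_support_le.
  by apply/seteqP; split => w /=; rewrite ltNge => /negP.
apply: le_trans (measureU2 _ (measurable_support_le t1) m2).
apply: le_measure; rewrite ?inE//.
by apply: measurableU => //; exact: measurable_support_le.
Qed.

End poisson_support.

(** * Cap volumes as multiples of [kappa d] *)

Section cap_volume_bounds.
Context {R : realType}.
Implicit Types (t a : R).

Lemma cap_volume_le d (u : 'rV[R]_d) t : (0 < d)%N -> unit_sphere u -> 0 <= t < 1 ->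
  cap_volume u t <=
    2 * d.+1%:R * (1 - t) * Num.sqrt (1 - t ^+ 2) ^+ d.-1 * kappa d.
Proof.
case: d u => // d u _ u1 t01; have := cap_le _ _ _ u1 t01.
rewrite cap_volume_fin lee_fin => /le_trans; apply => /=.
rewrite [leRHS](_ : _ = (1 - t) * Num.sqrt (1 - t ^+ 2) ^+ d * (2 * d.+2%:R * kappa d.+1)).
  rewrite ler_wpM2l ?kappa_le_kappaS// mulr_ge0 ?exprn_ge0 ?sqrtr_ge0//.
  by case/andP: t01 => _ /ltW; rewrite subr_ge0.
by ring.
Qed.

Lemma cap_volume_le_ball d (u : 'rV[R]_d) t : unit_sphere u -> 0 <= t < 1 ->
  cap_volume u t <= Num.sqrt (1 - t ^+ 2) ^+ d * kappa d.
Proof.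
by move=> u1 t01; have := cap_le_ball _ _ _ u1 t01; rewrite cap_volume_fin lee_fin.
Qed.

Lemma cap_volume_le_expR d (u : 'rV[R]_d) t : unit_sphere u -> 0 <= t ->
  cap_volume u t <= expR (- (t ^+ 2 * d%:R / 2)) * kappa d.
Proof.
by move=> u1 t0; have := cap_le_expR _ _ _ u1 t0; rewrite cap_volume_fin lee_fin.
Qed.

Lemma cap_volume_ge d (u : 'rV[R]_d) t a : (0 < d)%N -> unit_sphere u ->
  0 <= t -> 0 < a -> t + a < 1 ->
  a * (Num.sqrt d%:R / 8) * Num.sqrt (1 - (t + a) ^+ 2) ^+ d.-1 * kappa d
    <= cap_volume u t.
Proof.
case: d u => // d u _ u1 t0 a0 ta; have := cap_ge _ _ _ _ u1 t0 a0 ta.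
rewrite cap_volume_fin lee_fin; apply: le_trans => /=.
have s0 : 0 < Num.sqrt d.+1%:R :> R by rewrite sqrtr_gt0 ltr0n.
have : Num.sqrt d.+1%:R / 8 * kappa d.+1 <= kappa d :> R.
  have := kappaS_le_kappa (R := R) d.
  by rewrite -ler_pdivrMl ?divr_gt0// invf_div.
set s := Num.sqrt _ ^+ d; move=> H.
rewrite [leLHS](_ : _ = a * s * (Num.sqrt d.+1%:R / 8 * kappa d.+1)); last by ring.
by rewrite ler_wpM2l// mulr_ge0 ?exprn_ge0 ?sqrtr_ge0// ltW.
Qed.

Lemma cap_volume_ge0 d (u : 'rV[R]_d) t : 0 <= cap_volume u t.
Proof. exact: fine_ge0. Qed.

Lemma cap_volume_eq0 d (u : 'rV[R]_d) t : unit_sphere u -> 1 <= t -> cap_volume u t = 0.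
Proof. by move=> u1 t1; rewrite /cap_volume cap_eq0// measure0. Qed.

End cap_volume_bounds.

(** * Reduction of convergence in probability to two deterministic limits *)

Section convergence.
Context {R : realType} {dp : measure_display} {Omega : measurableType dp}.
Variable P : probability Omega R.
Variables (lambda : nat -> R) (X : forall d : nat, Omega -> set 'rV[R]_d)
  (u : forall d : nat, 'rV[R]_d).
Hypothesis X_poisson : forall d : nat, (2 <= d)%N -> poisson_process P (lambda d) (X d).

Local Notation h d w := (support_function (poisson_polytope (X d) w) (u d)).

(** A deviation forces [h] below [t1] or above [t2], with total probability at most [exp (- lambda
    V(t1)) + 1 - exp (- lambda V(t2))], which tends to 0. *)
Lemma cvg_in_probability_support (Y : nat -> Omega -> \bar R) (c : R) :
  (forall d, (2 <= d)%N -> measurable_fun setT (Y d)) ->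
  (forall e, 0 < e < 2^-1 -> exists t1 t2 : nat -> R,
    [/\ \forall d \near \oo, forall w, (e%:E < `|Y d w - c%:E|)%E ->
          (h d w <= (t1 d)%:E \/ (t2 d)%:E < h d w)%E,
        lambda d * cap_volume (u d) (t1 d) @[d --> \oo] --> +oo &
        lambda d * cap_volume (u d) (t2 d) @[d --> \oo] --> 0]) ->
  cvg_in_probability P Y c.
Proof.
move=> mY Yt e e0.
(* Lowering the tolerance only enlarges the deviation event, so small tolerances suffice; this keeps
   factors such as [1 - e] positive. *)
pose e' := Num.min e 4^-1.
have e'0 : 0 < e' < 2^-1.
  by rewrite /e' lt_min e0/= invr_gt0 ltr0n/= gt_min ltf_pV2 ?posrE// ltr_nat orbT.
have [t1 [t2 [Yh cvg1 cvg2]]] := Yt e' e'0.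
pose F d := expR (- (lambda d * cap_volume (u d) (t1 d))) +
     (1 - expR (- (lambda d * cap_volume (u d) (t2 d)))).
have F0 : F d @[d --> \oo] --> 0.
  rewrite (_ : 0 = 0 + (1 - expR (- 0)) :> R); last by rewrite oppr0 expR0 subrr addr0.
  apply: cvgD; first exact: (cvg_comp _ _ cvg1 (@cvgr_expR R)).
  apply: cvgB; first exact: cvg_cst.
  by apply: continuous_cvg; [exact: continuous_expR|exact: cvgN].
apply: (@squeeze_cvge _ _ _ _ (cst 0%E) _ (EFin \o F)); last 2 first.
- exact: cvg_cst.
- by apply/cvg_EFin => //; exact: nearW.
near=> d; rewrite measure_ge0/=.
have d2 : (2 <= d)%N by near: d; exact: nbhs_infty_ge.
apply: (prob_support_dev _ _ _ _ (X_poisson d d2)).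
  have mabs : measurable_fun setT (fun w => `|Y d w - c%:E|%E).
    apply: measurableT_comp => //; apply: emeasurable_funB => //; exact: mY.
  by rewrite -[X in measurable X]setTI; exact: emeasurable_fun_o_infty.
move=> w ew; have : (e'%:E < `|Y d w - c%:E|)%E.
  by apply: le_lt_trans ew; rewrite lee_fin ge_min lexx.
by move: w {ew}; near: d.
Unshelve. all: by end_near. Qed.

End convergence.

(** * Limits of exponentials and comparison of sequences *)

Section exponential_growth.
Context {R : realType}.

Lemma sqrtr_exprnE (x : R) n : 0 < x -> Num.sqrt x ^+ n = expR (n%:R * (ln x / 2)).
Proof.
move=> x0; rewrite expRM_natl; congr (_ ^+ n).
rewrite [in LHS](_ : x = expR (ln x / 2) ^+ 2) ?sqrtr_sqr ?ger0_norm ?expR_ge0//.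
by rewrite -expRM_natl mulrC divfK// lnK.
Qed.

Lemma cvg_expR_dvg (g : nat -> R) :
  g n @[n --> \oo] --> +oo -> expR (g n) @[n --> \oo] --> +oo.
Proof.
move=> /cvgryPge gy; apply/cvgryPge => A; near=> n.
have : A <= g n by near: n; exact: gy.
by move=> /le_trans; apply; have := @expR_ge1Dx R (g n); lra.
Unshelve. all: by end_near. Qed.

Lemma cvg_expR_0 (g : nat -> R) :
  g n @[n --> \oo] --> +oo -> expR (- g n) @[n --> \oo] --> 0.
Proof. by move=> gy; exact: (cvg_comp _ _ gy (@cvgr_expR R)). Qed.

Lemma cvg_mulr_natr (c : R) : 0 < c -> c * n%:R @[n --> \oo] --> +oo.
Proof.
move=> c0; apply/cvgryPge => A; near=> n.
rewrite -ler_pdivrMl//; near: n; exact: nbhs_infty_ger.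
Unshelve. all: by end_near. Qed.

Lemma squeeze_to0 (f g : nat -> R) :
  (\forall n \near \oo, 0 <= f n <= g n) ->
  g n @[n --> \oo] --> 0 -> f n @[n --> \oo] --> 0.
Proof. by move=> fg g0; by apply: (squeeze_cvgr (f := cst 0) (h := g) fg _ g0); exact: cvg_cst. Qed.

Lemma scale_dvg (c : R) (f g : nat -> R) : 0 < c ->
  (\forall n \near \oo, c * g n <= f n) ->
  g n @[n --> \oo] --> +oo -> f n @[n --> \oo] --> +oo.
Proof.
move=> c0 fg /cvgryPge gy; apply/cvgryPge => A; near=> n.
apply: (@le_trans _ _ (c * g n)); last by near: n.
by rewrite -ler_pdivrMl//; near: n; exact: gy.
Unshelve. all: by end_near. Qed.

End exponential_growth.

(** * Finite positive [x]: levels independent of [d] *)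

Section case_b.
Context {R : realType}.
Variables (lambda : nat -> R) (u : forall d : nat, 'rV[R]_d) (r : R).
Hypothesis lambda_gt0 : forall d : nat, (2 <= d)%N -> 0 < lambda d.
Hypothesis u_sphere : forall d : nat, (2 <= d)%N -> unit_sphere (u d).
Local Notation ell d := (ln (lambda d * kappa d)).
Hypothesis x_lim : ell d / d%:R @[d --> \oo] --> r.

Lemma expR_ell d : (2 <= d)%N -> expR (ell d) = lambda d * kappa d.
Proof. by move=> d2; rewrite lnK// posrE mulr_gt0// ?kappa_gt0// lambda_gt0. Qed.

Lemma fixed_level_above t : 0 <= t -> ln (1 - t ^+ 2) < - 2 * r -> t < 1 ->
  lambda d * cap_volume (u d) t @[d --> \oo] --> 0.
Proof.
move=> t0 tr t1; have rho0 : 0 < 1 - t ^+ 2 by nra.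
set y := ln (1 - t ^+ 2) in tr *.
(* Half the gap between the decay rate [- y / 2] of the volume and the growth rate [r] of the
   intensity; the other half absorbs the error in [ell d / d]. *)
pose c := (- y / 2 - r) / 2; have c0 : 0 < c by rewrite /c; lra.
apply: (squeeze_to0 _ (fun d => expR (- (c * d%:R)))); last first.
  exact/cvg_expR_0/cvg_mulr_natr.
near=> d; have d2 : (2 <= d)%N by near: d; exact: nbhs_infty_ge.
have d0 : 0 < d%:R :> R by rewrite ltr0n; exact: leq_trans d2.
rewrite mulr_ge0 ?cap_volume_ge0 ?(ltW (lambda_gt0 _ d2))//=.
apply: le_trans (ler_wpM2l (ltW (lambda_gt0 _ d2)) (cap_volume_le_ball d _ _ (u_sphere _ d2) _)) _.
  by rewrite t0.
rewrite mulrCA -expR_ell// sqrtr_exprnE// -expRD ler_expR -/y.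
have : ell d / d%:R <= r + c.
  by near: d; move/cvgrPdist_le : x_lim => /(_ _ c0); apply: filterS => d; rewrite ler_norml; lra.
rewrite ler_pdivrMr// => H.
rewrite [leLHS](_ : _ = ell d + y / 2 * d%:R); last by ring.
apply: le_trans (lerD H (lexx _)) _.
by rewrite -mulrDl -mulNr ler_pM2r// /c; lra.
Unshelve. all: by end_near. Qed.

Lemma fixed_level_below t a : 0 <= t -> 0 < a -> t + a < 1 ->
  - 2 * r < ln (1 - (t + a) ^+ 2) ->
  lambda d * cap_volume (u d) t @[d --> \oo] --> +oo.
Proof.
move=> t0 a0 t1 tr; have rho0 : 0 < 1 - (t + a) ^+ 2 by nra.
have rho1 : 1 - (t + a) ^+ 2 <= 1 by rewrite gerBl sqr_ge0.
set y := ln (1 - (t + a) ^+ 2) in tr *.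
pose c := (r + y / 2) / 2; have c0 : 0 < c by rewrite /c; lra.
apply: (scale_dvg (a / 8) _ (fun d => expR (c * d%:R))); first lra; last first.
  exact/cvg_expR_dvg/cvg_mulr_natr.
near=> d; have d2 : (2 <= d)%N by near: d; exact: nbhs_infty_ge.
have d1 : (0 < d)%N by exact: leq_trans d2.
have d0 : 0 < d%:R :> R by rewrite ltr0n.
have H1 : 1 <= Num.sqrt d%:R :> R by rewrite -[leLHS]sqrtr1 ler_wsqrtr// ler1n.
have l0 := ltW (lambda_gt0 _ d2).
apply: le_trans _ (ler_wpM2l l0 (cap_volume_ge d _ _ _ d1 (u_sphere _ d2) t0 a0 t1)).
have : r - c <= ell d / d%:R.
  by near: d; move/cvgrPdist_le : x_lim => /(_ _ c0); apply: filterS => d; rewrite ler_norml; lra.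
rewrite ler_pdivlMr// => H.
set s := Num.sqrt (1 - _).
(* Since [s <= 1], raising the exponent from [d - 1] to [d] keeps a lower bound and lets the
   exponential rate be exactly [y / 2] per dimension. *)
have sd : s ^+ d <= s ^+ d.-1.
  rewrite -[in leLHS](prednK d1) exprS ler_piMl ?exprn_ge0 ?sqrtr_ge0//.
  by rewrite /s -[leRHS]sqrtr1 ler_wsqrtr.
have H2 : expR (c * d%:R) <= lambda d * kappa d * s ^+ d.
  rewrite -expR_ell// /s sqrtr_exprnE// -expRD ler_expR -/y.
  rewrite [leRHS](_ : _ = ell d + y / 2 * d%:R); last by ring.
  by apply: le_trans (lerD H (lexx _)); rewrite -mulrDl ler_pM2r// /c; lra.
have {}sd : lambda d * kappa d * s ^+ d <= lambda d * kappa d * s ^+ d.-1.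
  by rewrite ler_wpM2l// mulr_ge0// kappa_ge0.
have {H2 sd}H3 := le_trans H2 sd.
rewrite [leRHS](_ : _ = a / 8 * (Num.sqrt d%:R * (lambda d * kappa d * s ^+ d.-1))); last by ring.
rewrite ler_pM2l ?divr_gt0//; apply: le_trans H3 _.
by rewrite ler_peMl// !mulr_ge0 ?kappa_ge0 ?exprn_ge0 ?sqrtr_ge0.
Unshelve. all: by end_near. Qed.

End case_b.

(** * The case [x = 0]: levels tending to 0 *)

Section case_a.
Context {R : realType}.
Variables (lambda : nat -> R) (u : forall d : nat, 'rV[R]_d).
Hypothesis lambda_gt0 : forall d : nat, (2 <= d)%N -> 0 < lambda d.
Hypothesis u_sphere : forall d : nat, (2 <= d)%N -> unit_sphere (u d).
Local Notation ell d := (ln (lambda d * kappa d)).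
Hypothesis ell_dvg : ell d @[d --> \oo] --> +oo.
Hypothesis ell_o : ell d / d%:R @[d --> \oo] --> 0.
Local Notation k d := (Num.sqrt (2 / d%:R * ell d)).

(** [k d] is the level at which the bound [exp (- t^2 * d / 2)] exactly cancels
    [lambda d * kappa d]. *)
Lemma sqr_small_level d : (2 <= d)%N -> 0 <= ell d -> k d ^+ 2 * d%:R / 2 = ell d.
Proof.
move=> d2 l0; have d0 : 0 < d%:R :> R by rewrite ltr0n; exact: leq_trans d2.
by rewrite sqr_sqrtr ?mulr_ge0 ?invr_ge0// ?(ltW d0)//; field; rewrite gt_eqF.
Qed.

(** At this level the exponential bound leaves [exp ((1 - (1 + e)^2) * ell d)]. As [ell d] may grow
    slowly, a bound without polynomial loss is required. *)
Lemma small_level_above e : 0 < e ->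
  lambda d * cap_volume (u d) ((1 + e) * k d) @[d --> \oo] --> 0.
Proof.
move=> e0; apply: (squeeze_to0 _ (fun d => expR (- (e * ell d)))); last first.
  apply: cvg_expR_0; apply: (scale_dvg e _ (fun d => ell d)) => //.
  by apply: nearW => d.
near=> d; have d2 : (2 <= d)%N by near: d; exact: nbhs_infty_ge.
have l0 : 0 <= ell d by near: d; move/cvgryPge : ell_dvg; exact.
have la0 := ltW (lambda_gt0 _ d2).
have t0 : 0 <= (1 + e) * k d by rewrite mulr_ge0 ?sqrtr_ge0//; lra.
rewrite mulr_ge0 ?cap_volume_ge0//=.
apply: le_trans (ler_wpM2l la0 (cap_volume_le_expR d _ _ (u_sphere _ d2) t0)) _.
rewrite mulrCA -[X in _ * X <= _](expR_ell _ lambda_gt0)// -expRD ler_expR.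
rewrite [X in - X](_ : _ = (1 + e) ^+ 2 * (k d ^+ 2 * d%:R / 2)); last by ring.
rewrite sqr_small_level//.
by nra.
Unshelve. all: by end_near. Qed.

Lemma small_level_cvg0 : k d ^+ 2 @[d --> \oo] --> 0.
Proof.
apply: (squeeze_to0 _ (fun d => 2 * (ell d / d%:R))); last first.
  by rewrite -[X in _ --> X](mulr0 2); apply: cvgM => //; exact: cvg_cst.
near=> d; have l0 : 0 <= ell d by near: d; move/cvgryPge : ell_dvg; exact.
rewrite sqr_ge0/= sqr_sqrtr; last by rewrite !mulr_ge0// invr_ge0.
by rewrite mulrAC mulrA.
Unshelve. all: by end_near. Qed.

(** This is [1 + z <= exp z] at [z = y / (1 - y)], where [1 + z = 1 / (1 - y)]. *)
Lemma ln_1B_ge (y : R) : 0 <= y < 1 -> - (y / (1 - y)) <= ln (1 - y).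
Proof.
move=> /andP[y0 y1]; have p : 0 < 1 - y by lra.
rewrite -ler_expR lnK// expRN invf_ple ?posrE ?expR_gt0//.
apply: le_trans (expR_ge1Dx _); rewrite le_eqVlt; apply/orP; left; apply/eqP.
by field; rewrite gt_eqF.
Qed.

Lemma small_level_below e : 0 < e < 1 ->
  lambda d * cap_volume (u d) ((1 - e) * k d) @[d --> \oo] --> +oo.
Proof.
move=> /andP[e0 e1].
(* The constant is the [e / 2] of the cylinder height [a = e / 2 * k d] times the [1 / 8] of
   [cap_volume_ge]. *)
apply: (scale_dvg (e / 16) _ (fun d => expR (e / 2 * ell d))); first lra; last first.
  apply: cvg_expR_dvg; apply: (scale_dvg (e / 2) _ (fun d => ell d)) => //; first lra.
  by apply: nearW => d.
near=> d; have d2 : (2 <= d)%N by near: d; exact: nbhs_infty_ge.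
have d1 : (0 < d)%N by exact: leq_trans d2.
have d0 : 0 < d%:R :> R by rewrite ltr0n.
have l1 : 1 <= ell d by near: d; move/cvgryPge : ell_dvg; exact.
have l0 : 0 <= ell d by lra.
have la0 := ltW (lambda_gt0 _ d2).
have k0 : 0 < k d by rewrite sqrtr_gt0 mulr_gt0 ?divr_gt0//; lra.
have k2 := sqr_small_level d d2 l0.
have ks : k d ^+ 2 < e / 2.
  by near: d; apply: (cvgr_lt 0); [exact: small_level_cvg0|lra].
set a := e / 2 * k d; set t := (1 - e) * k d.
have ta : t + a = (1 - e / 2) * k d by rewrite /t /a; lra.
have a0 : 0 < a by rewrite mulr_gt0//; lra.
have t0 : 0 <= t by rewrite mulr_ge0// ltW//; lra.
have k1 : k d < 1 by nra.
have t1 : t + a < 1 by rewrite ta; nra.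
apply: le_trans _ (ler_wpM2l la0 (cap_volume_ge d _ _ _ d1 (u_sphere _ d2) t0 a0 t1)).
set y := (t + a) ^+ 2; set s := Num.sqrt (1 - y).
have y0 : 0 <= y by rewrite sqr_ge0.
have ye : y < e / 2.
  by rewrite /y ta exprMn; have := sqr_ge0 (k d); nra.
have sd : s ^+ d <= s ^+ d.-1.
  rewrite -[in leLHS](prednK d1) exprS ler_piMl ?exprn_ge0 ?sqrtr_ge0//.
  by rewrite /s -[leRHS]sqrtr1 ler_wsqrtr// gerBl.
(* The cylinder height is of order [sqrt (ell d / d)]; the factor [sqrt d] of [cap_volume_ge] makes
   up for it, as [sqrt d * k d = sqrt (2 * ell d)]. *)
have sk : 1 <= Num.sqrt d%:R * k d.
  rewrite -sqrtrM ?ler0n// -[leLHS]sqrtr1 ler_wsqrtr//.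
  rewrite (_ : d%:R * _ = 2 * ell d); first lra.
  by field; rewrite gt_eqF.
have H2 : expR (e / 2 * ell d) <= lambda d * kappa d * s ^+ d.
  rewrite -[X in _ <= X * _](expR_ell _ lambda_gt0)// /s sqrtr_exprnE; last lra.
  rewrite -expRD ler_expR.
  have : - (y / (1 - y)) <= ln (1 - y) by apply: ln_1B_ge; rewrite y0/=; lra.
  move=> H.
  have : d%:R * (- (y / (1 - y)) / 2) <= d%:R * (ln (1 - y) / 2).
    by rewrite ler_wpM2l// ler_pM2r ?invr_gt0.
  move/(lerD (lexx (ell d))); apply: le_trans.
  have -> : d%:R * (- (y / (1 - y)) / 2) = - ((1 - e / 2) ^+ 2 * ell d / (1 - y)).
    rewrite -k2 {1}/y ta exprMn; field; lra.
  (* As [y < e / 2], one factor [1 - e / 2] pays for the division by [1 - y]; the other leaves the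
     surplus [e / 2 * ell d]. *)
  have : (1 - e / 2) ^+ 2 * ell d / (1 - y) <= (1 - e / 2) * ell d.
    rewrite ler_pdivrMr; last lra.
    by rewrite expr2 -!mulrA ler_wpM2l; [|lra|rewrite mulrC ler_wpM2l//; lra].
  by lra.
have {}sd : lambda d * kappa d * s ^+ d <= lambda d * kappa d * s ^+ d.-1.
  by rewrite ler_wpM2l// mulr_ge0// kappa_ge0.
have {H2 sd}H3 := le_trans H2 sd.
rewrite [leRHS](_ : _ = e / 16 * (Num.sqrt d%:R * k d * (lambda d * kappa d * s ^+ d.-1))); last first.
  by rewrite /a; field.
rewrite ler_pM2l ?divr_gt0//; apply: le_trans H3 _.
by rewrite ler_peMl// !mulr_ge0 ?kappa_ge0 ?exprn_ge0 ?sqrtr_ge0.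
Unshelve. all: by end_near. Qed.

End case_a.

(** * Infinite [x]: levels tending to 1 *)

Section case_c.
Context {R : realType}.
Variables (lambda : nat -> R) (u : forall d : nat, 'rV[R]_d).
Hypothesis lambda_gt0 : forall d : nat, (2 <= d)%N -> 0 < lambda d.
Hypothesis u_sphere : forall d : nat, (2 <= d)%N -> unit_sphere (u d).
Local Notation ell d := (ln (lambda d * kappa d)).
Hypothesis x_lim : ell d / d%:R @[d --> \oo] --> +oo.
Local Notation k d := (2^-1 * (lambda d * kappa d) `^ (- (2 / (d.+1)%:R))).

(** The power [- 1 / (d + 1)] of [lambda d * kappa d]. At distance [g^2 / 2] from the boundary a cap
    has base radius about [g]; the height supplies two powers of [g] and the base [d - 1], whence
    the exponent [d + 1]. *)
Let g d := expR (- (ell d / d.+1%:R)).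

Let kE d : (2 <= d)%N -> k d = g d ^+ 2 / 2.
Proof.
move=> d2; have L0 : 0 < lambda d * kappa d by rewrite mulr_gt0 ?kappa_gt0 ?lambda_gt0.
rewrite /powR gt_eqF// mulrC /g -expRM_natl; congr (expR _ / 2).
by rewrite -!mulNr; field; rewrite addr_eq0 gt_eqF// ltr_pwDl// ?ltr01// ler0n.
Qed.

Let gXS d : (2 <= d)%N -> lambda d * kappa d * g d ^+ d.+1 = 1.
Proof.
move=> d2; rewrite -[X in X * _](expR_ell _ lambda_gt0)// /g -expRM_natl -expRD.
rewrite -[RHS]expR0; congr expR.
by field; rewrite addr_eq0 gt_eqF// ltr_pwDl// ?ltr01// ler0n.
Qed.

Let g_cvg0 : g d @[d --> \oo] --> 0.
Proof.
apply: cvg_expR_0; apply: (scale_dvg 2^-1 _ (fun d => ell d / d%:R)) => //.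
near=> d; have d2 : (2 <= d)%N by near: d; exact: nbhs_infty_ge.
have d0 : 0 < d%:R :> R by rewrite ltr0n; exact: leq_trans d2.
have l0 : 0 <= ell d / d%:R by near: d; move/cvgryPge : x_lim; exact.
rewrite ler_pdivlMr ?ltr0n//; set q := ell d / d%:R in l0 *.
have -> : ell d = q * d%:R by rewrite /q divfK// gt_eqF.
have : 2 <= d%:R :> R by rewrite ler_nat.
by rewrite -[d.+1%:R]natr1; nra.
Unshelve. all: by end_near. Qed.

Let exprSS_pred (x : R) d : (0 < d)%N -> x ^+ d.+1 = x ^+ 2 * x ^+ d.-1.
Proof. by case: d => // d _; rewrite -exprD. Qed.

Lemma high_level_cvg0 : k d @[d --> \oo] --> 0.
Proof.
apply: (squeeze_to0 _ g) => //; near=> d.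
have d2 : (2 <= d)%N by near: d; exact: nbhs_infty_ge.
have g1 : g d < 1 by near: d; apply: (cvgr_lt 0).
have g0 : 0 < g d := expR_gt0 _.
by rewrite kE//; nra.
Unshelve. all: by end_near. Qed.

Lemma high_level_above e : 0 < e < 1 ->
  lambda d * cap_volume (u d) (1 - (1 - e) * k d) @[d --> \oo] --> 0.
Proof.
move=> /andP[e0 e1]; have p : 0 < 1 - e by lra.
(* Chosen so that [sqrt (1 - e) ^ (d + 1) = exp (- 2 * c * (d + 1))]: half of this decay absorbs the
   polynomial factor [d + 1], the other half gives the limit. *)
pose c := - ln (1 - e) / 4.
have c0 : 0 < c.
  by rewrite /c divr_gt0// oppr_gt0 ln_lt0//; lra.
apply: (squeeze_to0 _ (fun d => c^-1 * expR (- (c * d.+1%:R)))); last first.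
  rewrite -[X in _ --> X](mulr0 c^-1); apply: cvgM; first exact: cvg_cst.
  apply: cvg_expR_0; apply: (scale_dvg 1 _ (fun d => c * d%:R)) => //; last exact: cvg_mulr_natr.
  by apply: nearW => d; rewrite mul1r ler_pM2l// ler_nat.
near=> d; have d2 : (2 <= d)%N by near: d; exact: nbhs_infty_ge.
have d1 : (0 < d)%N by exact: leq_trans d2.
have la0 := ltW (lambda_gt0 _ d2).
have g1 : g d < 1 by near: d; apply: (cvgr_lt 0).
have g0 : 0 < g d := expR_gt0 _.
rewrite mulr_ge0 ?cap_volume_ge0//= kE//.
set t := 1 - _.
have K0 : 0 < (1 - e) * (g d ^+ 2 / 2) by rewrite mulr_gt0// divr_gt0// exprn_gt0.
have K1 : (1 - e) * (g d ^+ 2 / 2) <= g d ^+ 2 / 2.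
  by rewrite ler_piMl// ?divr_ge0 ?sqr_ge0//; lra.
have g2 : g d ^+ 2 < 1 by rewrite exprn_ilt1// ltW.
have t01 : 0 <= t < 1 by rewrite /t; apply/andP; split; lra.
apply: le_trans (ler_wpM2l la0 (cap_volume_le d _ _ d1 (u_sphere _ d2) t01)) _.
(* Uses [1 - t^2 <= 2 * (1 - t) = (1 - e) * g^2]. *)
have st : Num.sqrt (1 - t ^+ 2) ^+ d.-1 <= (Num.sqrt (1 - e) * g d) ^+ d.-1.
  rewrite lerXn2r ?nnegrE ?sqrtr_ge0// ?mulr_ge0 ?sqrtr_ge0 ?(ltW g0)//.
  rewrite -[g d](ger0_norm (ltW g0)) -sqrtr_sqr -sqrtrM ?(ltW p)// ler_wsqrtr//.
  by rewrite /t; have := sqr_ge0 ((1 - e) * (g d ^+ 2 / 2)); lra.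
have step : 2 * d.+1%:R * (1 - t) * Num.sqrt (1 - t ^+ 2) ^+ d.-1 * kappa d <=
    2 * d.+1%:R * (1 - t) * (Num.sqrt (1 - e) * g d) ^+ d.-1 * kappa d.
  rewrite ler_wpM2r ?kappa_ge0// ler_wpM2l// mulr_ge0// ?mulr_ge0//.
  by case/andP: t01; lra.
apply: le_trans (ler_wpM2l la0 step) _.
(* The factor [2 * (1 - t) = (1 - e) * g^2] completes both powers from [d - 1] to [d + 1], after
   which [gXS] cancels the intensity. *)
have -> : lambda d * (2 * d.+1%:R * (1 - t) * (Num.sqrt (1 - e) * g d) ^+ d.-1 * kappa d)
    = d.+1%:R * Num.sqrt (1 - e) ^+ d.+1.
  rewrite -[RHS]mulr1 -[X in _ = _ * X](gXS d d2) /t.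
  by rewrite (exprSS_pred (g d) d d1) (exprSS_pred (Num.sqrt _) d d1) sqr_sqrtr ?(ltW p)// exprMn; field.
rewrite sqrtr_exprnE// (_ : d.+1%:R * (ln (1 - e) / 2) = c * d.+1%:R - 2 * (c * d.+1%:R) - c * d.+1%:R); last first.
  by rewrite /c; field.
set z := c * d.+1%:R.
have -> : d.+1%:R = c^-1 * z by rewrite /z mulrA mulVf ?mul1r// gt_eqF.
rewrite -mulrA ler_pM2l ?invr_gt0//.
have -> : z - 2 * z - z = - z - z by ring.
rewrite expRD mulrA ler_piMl ?expR_ge0// expRN ler_pdivrMr ?expR_gt0// mul1r.
by have := @expR_ge1Dx R z; lra.
Unshelve. all: by end_near. Qed.

Lemma high_level_below e : 0 < e < 1 ->
  lambda d * cap_volume (u d) (1 - (1 + e) * k d) @[d --> \oo] --> +oo.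
Proof.
move=> /andP[e0 e1].
pose c := ln (1 + e / 4) / 2.
have c0 : 0 < c by rewrite /c divr_gt0// ln_gt0//; lra.
(* [a / 8] equals [e * g^2 / 32]; dividing by [1 + e / 4] pays for completing the power of
   [sqrt (1 + e / 4)] from [d - 1] to [d + 1]. *)
pose C := e / (32 * (1 + e / 4)).
have C0 : 0 < C by rewrite /C divr_gt0//; lra.
apply: (scale_dvg C _ (fun d => expR (c * d%:R))) => //; last first.
  exact/cvg_expR_dvg/cvg_mulr_natr.
near=> d; have d2 : (2 <= d)%N by near: d; exact: nbhs_infty_ge.
have d1 : (0 < d)%N by exact: leq_trans d2.
have la0 := ltW (lambda_gt0 _ d2).
have kk : k d < e / 16 by near: d; apply: (cvgr_lt 0); [exact: high_level_cvg0|lra].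
have k0 : 0 < k d.
  by rewrite kE//; have := expR_gt0 (- (ell d / d.+1%:R)); rewrite -/(g d) => ?; nra.
have g0 : 0 < g d := expR_gt0 _.
have H1 : 1 <= Num.sqrt d%:R :> R by rewrite -[leLHS]sqrtr1 ler_wsqrtr// ler1n.
set t := 1 - _; set a := e / 2 * k d.
have a0 : 0 < a by rewrite mulr_gt0//; lra.
have t0 : 0 <= t by rewrite /t; nra.
have t1 : t + a < 1 by rewrite /t /a; nra.
apply: le_trans _ (ler_wpM2l la0 (cap_volume_ge d _ _ _ d1 (u_sphere _ d2) t0 a0 t1)).
(* With [m = (1 + e / 2) * k d], [1 - (1 - m)^2 = 2 * m - m^2]; for small [k d] the term [m^2] costs
   at most [e / 2 * k d], which degrades [e / 2] to [e / 4]. *)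
have st : (Num.sqrt (1 + e / 4) * g d) ^+ d.-1 <= Num.sqrt (1 - (t + a) ^+ 2) ^+ d.-1.
  rewrite lerXn2r ?nnegrE ?sqrtr_ge0// ?mulr_ge0 ?sqrtr_ge0 ?(ltW g0)//.
  rewrite -[g d](ger0_norm (ltW g0)) -sqrtr_sqr -sqrtrM; last lra.
  rewrite ler_wsqrtr//.
  have -> : g d ^+ 2 = 2 * k d by rewrite kE//; field.
  have -> : t + a = 1 - (1 + e / 2) * k d by rewrite /t /a; field.
  have : (1 + e / 2) ^+ 2 * k d <= e / 2 by have := ltW k0; nra.
  by rewrite -(ler_pM2r k0); lra.
have s1 : 1 <= Num.sqrt (1 + e / 4) by rewrite -[leLHS]sqrtr1 ler_wsqrtr//; lra.
have step : a * (Num.sqrt d%:R / 8) * (Num.sqrt (1 + e / 4) * g d) ^+ d.-1 * kappa d <=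
    a * (Num.sqrt d%:R / 8) * Num.sqrt (1 - (t + a) ^+ 2) ^+ d.-1 * kappa d.
  rewrite ler_wpM2r ?kappa_ge0// ler_wpM2l// mulr_ge0// ?divr_ge0 ?sqrtr_ge0//.
  exact: ltW.
apply: le_trans _ (ler_wpM2l la0 step).
have -> : lambda d * (a * (Num.sqrt d%:R / 8) * (Num.sqrt (1 + e / 4) * g d) ^+ d.-1 * kappa d)
    = C * (Num.sqrt d%:R * Num.sqrt (1 + e / 4) ^+ d.+1).
  rewrite -[RHS]mulr1 -[X in _ = _ * X](gXS d d2) /a kE//.
  have e40 : 1 + e / 4 != 0 by rewrite gt_eqF//; lra.
  rewrite (exprSS_pred (g d) d d1) (exprSS_pred (Num.sqrt _) d d1) sqr_sqrtr; last lra.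
  by rewrite exprMn /C; field; lra.
rewrite ler_pM2l// -[leLHS]mul1r ler_pM ?expR_ge0// sqrtr_exprnE; last lra.
by rewrite -/c ler_expR mulrC ler_pM2r// ler_nat.
Unshelve. all: by end_near. Qed.

End case_c.

(** * Deviation events for extended real values *)

Section deviation.
Context {R : realType}.
Local Open Scope ereal_scope.

(** The value [-oo] of an empty polytope falls on the lower side. *)
Lemma dev_center (h : \bar R) (c e : R) : e%:E < `|h - c%:E| ->
  h <= (c - e)%:E \/ (c + e)%:E < h.
Proof.
case: h => [r| |]; [|by right; rewrite ltry|by left; rewrite leNye].
rewrite -EFinB abse_EFin lte_fin lee_fin lte_fin lter_normr.
by move=> /orP[?|?]; [right|left]; lra.
Qed.

Lemma dev_ratio (h : \bar R) (k e : R) : (0 < k)%R -> e%:E < `|h / k%:E - 1| ->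
  h < ((1 - e) * k)%:E \/ ((1 + e) * k)%:E < h.
Proof.
move=> k0; case: h => [r| |]; [|by right; rewrite ltry|by left; rewrite ltNyr].
rewrite inver gt_eqF// -EFinM -EFinB abse_EFin !lte_fin lter_normr.
rewrite -(ltr_pdivlMr _ r k0) -(ltr_pdivrMr _ r k0).
by move=> /orP[?|?]; [right|left]; lra.
Qed.

Lemma dev_ratio1B (h : \bar R) (k e : R) : (0 < k)%R -> e%:E < `|(1 - h) / k%:E - 1| ->
  h <= (1 - (1 + e) * k)%:E \/ (1 - (1 - e) * k)%:E < h.
Proof.
move=> k0 /(dev_ratio _ _ _ k0).
case: h => [r| |]; [|by right; rewrite ltry|by left; rewrite leNye].
by rewrite -EFinB lee_fin !lte_fin => -[?|?]; [right|left]; lra.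
Qed.

End deviation.

(** The liminf is the supremum of the tail infima, so one of these already exceeds [a]. *)
Lemma limn_einf_gt {R : realType} (f : nat -> R) (a : R) :
  (a%:E < limn_einf (fun d => (f d)%:E))%E -> \forall d \near \oo, a < f d.
Proof.
rewrite limn_einf_lim (cvg_lim _ (@cvg_einfs_sup _ _))//.
move=> /ereal_sup_gt[_ [N _ <-] HN].
near=> d; have dN : (N <= d)%N by near: d; exact: nbhs_infty_ge.
rewrite -lte_fin; apply: lt_le_trans HN _.
by apply: ereal_inf_lbound; exists d => /=.
Unshelve. all: by end_near. Qed.

Theorem theorem1 (R : realType) (dp : measure_display)
    (Omega : measurableType dp) (P : probability Omega R)
    (lambda : nat -> R) (X : forall d : nat, Omega -> set 'rV[R]_d)
    (u : forall d : nat, 'rV[R]_d) (x : \bar R)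
    (lambda_gt0 : forall d : nat, (2 <= d)%N -> 0 < lambda d)
    (X_poisson : forall d : nat, (2 <= d)%N ->
       poisson_process P (lambda d) (X d))
    (u_sphere : forall d : nat, (2 <= d)%N -> unit_sphere (u d))
    (liminf_gt2 :
       (2%:E < limn_einf (fun d : nat => (lambda d * kappa d / d%:R)%:E))%E)
    (x_ge0 : (0 <= x)%E)
    (x_lim : (ln (lambda d * kappa d) / d%:R)%:E @[d --> \oo] --> x) :
  let h (d : nat) (w : Omega) : \bar R :=
    support_function (poisson_polytope (X d) w) (u d) in
  [/\ x = 0%E ->
        cvg_in_probability P
          (fun d w =>
             (h d w / (Num.sqrt (2 / d%:R * ln (lambda d * kappa d)))%:E)%E) 1,
      forall r : R, 0 < r -> x = r%:E ->
        cvg_in_probability P h (Num.sqrt (1 - expR (- 2 * r)))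
    & x = +oo%E ->
        cvg_in_probability P
          (fun d w =>
             ((1 - h d w) /
              (2^-1 * (lambda d * kappa d) `^ (- (2 / (d.+1)%:R)))%:E)%E) 1].
Proof.
set L := fun d => lambda d * kappa d.
have mh d : (2 <= d)%N ->
    measurable_fun setT (fun w => support_function (poisson_polytope (X d) w) (u d)).
  by move=> d2; exact: measurable_support (X_poisson d d2).
split=> [x0|r r0 xr|xy].
- have ell_o : ln (L d) / d%:R @[d --> \oo] --> 0.
    by move: x_lim; rewrite x0 => /fine_cvg.
  (* The liminf bound gives [d <= lambda d * kappa d] eventually, so the logarithm diverges although
     its quotient by [d] tends to 0. *)
  have ell_dvg : ln (L d) @[d --> \oo] --> +oo.
    apply/cvgryPge => A; near=> d.
    have d0 : 0 < d%:R :> R by rewrite ltr0n; near: d; exact: nbhs_infty_gt.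
    have dA : expR A <= d%:R by near: d; exact: nbhs_infty_ger.
    have dL : 2 < L d / d%:R by near: d; exact: limn_einf_gt liminf_gt2.
    have Ld : d%:R <= L d by move: dL; rewrite ltr_pdivlMr//; lra.
    by rewrite -ler_expR lnK ?posrE; lra.
  apply: (cvg_in_probability_support P lambda X u X_poisson) => [d d2|e /andP[e0 e2]].
    by apply: emeasurable_funM => //; exact: mh.
  pose k d := Num.sqrt (2 / d%:R * ln (L d)).
  exists (fun d => (1 - e) * k d), (fun d => (1 + e) * k d); split.
  + near=> d => w.
    have d0 : 0 < d%:R :> R by rewrite ltr0n; near: d; exact: nbhs_infty_gt.
    have l1 : 1 <= ln (L d) by near: d; move/cvgryPge : ell_dvg; exact.
    have k0 : 0 < k d by rewrite sqrtr_gt0 mulr_gt0 ?divr_gt0//; lra.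
    by move=> /(dev_ratio _ _ _ k0)[/ltW|]; [left|right].
  + by apply: small_level_below => //; rewrite e0/=; lra.
  + exact: small_level_above.
- have ell_r : ln (L d) / d%:R @[d --> \oo] --> r.
    by move: x_lim; rewrite xr => /fine_cvg.
  set s := Num.sqrt _.
  have E0 : 0 < expR (- 2 * r) := expR_gt0 _.
  have E1 : expR (- 2 * r) < 1 by rewrite expR_lt1; lra.
  have s2 : s ^+ 2 = 1 - expR (- 2 * r) by rewrite sqr_sqrtr//; lra.
  have s0 : 0 < s by rewrite sqrtr_gt0; lra.
  have s1 : s < 1 by nra.
  apply: (cvg_in_probability_support P lambda X u X_poisson) => [d d2|e /andP[e0 e2]].
    exact: mh.
  (* [s - e] may be negative, whereas the cap bounds need a nonnegative level; [s / 2] remains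
     strictly below [s]. *)
  pose t1 := Num.max (s - e) (s / 2).
  have t1s : t1 < s by rewrite gt_max; apply/andP; split; lra.
  have t10 : 0 <= t1 by rewrite le_max; apply/orP; right; lra.
  exists (fun=> t1), (fun=> s + e); split.
  + apply: nearW => d w /dev_center[ht|]; [left|by right].
    by apply: le_trans ht _; rewrite lee_fin le_max lexx.
  (* The cylinder stops at the midpoint of [t1] and [s], still strictly below the critical level
     [s], where [ln (1 - s^2) = - 2 * r]. *)
  + apply: (fixed_level_below lambda u r lambda_gt0 u_sphere ell_r t1 ((s - t1) / 2)) => //; try lra.
    set y := t1 + _; have ys : y ^+ 2 < s ^+ 2.
      by rewrite ltr_sqr ?nnegrE /y; lra.
    by rewrite -ltr_expR lnK ?posrE; lra.
  + have [t1'|t1'] := ltP (s + e) 1; last first.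
      apply: (squeeze_to0 _ (cst 0)); last exact: cvg_cst.
      near=> d; have d2 : (2 <= d)%N by near: d; exact: nbhs_infty_ge.
      by rewrite (cap_volume_eq0 _ _ _ (u_sphere _ d2))// mulr0 lexx.
    apply: (fixed_level_above lambda u r lambda_gt0 u_sphere ell_r) => //; first lra.
    have te1 : (s + e) ^+ 2 < 1 by rewrite expr_lt1//; lra.
    rewrite -ltr_expR lnK ?posrE; last lra.
    have : s ^+ 2 < (s + e) ^+ 2 by rewrite ltr_sqr ?nnegrE; lra.
    by lra.
- have ell_y : ln (L d) / d%:R @[d --> \oo] --> +oo.
    by apply/cvgeryP; rewrite -xy.
  apply: (cvg_in_probability_support P lambda X u X_poisson) => [d d2|e /andP[e0 e2]].
    apply: emeasurable_funM => //; apply: emeasurable_funB => //; exact: mh.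
  pose k d := 2^-1 * (L d) `^ (- (2 / (d.+1)%:R)).
  exists (fun d => 1 - (1 + e) * k d), (fun d => 1 - (1 - e) * k d); split.
  + near=> d => w.
    have d2 : (2 <= d)%N by near: d; exact: nbhs_infty_ge.
    have k0 : 0 < k d.
      by rewrite mulr_gt0// powR_gt0// mulr_gt0 ?kappa_gt0 ?lambda_gt0.
    exact: dev_ratio1B.
  + by apply: high_level_below => //; rewrite e0/=; lra.
  + by apply: high_level_above => //; rewrite e0/=; lra.
Unshelve. all: by end_near. Qed.
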